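(* Let $X,Y,Z,W$ be compact metric spaces with uniformly contractive iterated function systems $\{\tau_x:Z\to Z\}_{x\in X}$ and $\{\tau_y:W\to W\}_{y\in Y}$, let $\alpha\in\mathcal{P}(X)$ and $\beta\in\mathcal{P}(Y)$ have full support, and let $\mu\in\mathcal{P}(X)$, $\nu\in\mathcal{P}(Y)$. For every continuous cost $c:X\times Y\times Z\times W\to\mathbb{R}$, $$\inf_{P_{\alpha,\beta}(c-\varphi(x)-\psi(y))=0}\ \int \varphi\,d\mu+\int\psi\,d\nu \;=\; \sup_{\pi\in\Pi(\mu,\nu,\tau)}\ \int c\,d\pi+H_\alpha(\pi)+H_\beta(\pi),$$ where the infimum is over all pairs of continuous functions $\varphi\in C(X)$, $\psi\in C(Y)$ such that the marginal pressure of the function $(x,y,z,w)\mapsto c(x,y,z,w)-\varphi(x)-\psi(y)$ equals $0$.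
   Context: $\mathcal{P}(S)$ is the set of Borel probability measures on a compact metric space $S$, and $C(S)$ the space of continuous real functions on $S$. Uniformly contractive means: there is a constant $0<\gamma<1$ with $d(\tau_{x_1}(z_1),\tau_{x_2}(z_2))\le\gamma[d(x_1,x_2)+d(z_1,z_2)]$ for all $x_i\in X$, $z_i\in Z$; likewise for $\{\tau_y\}$ on $Y,W$. Lipschitz on $X\times Z$ refers to the metric $d(x_1,x_2)+d(z_1,z_2)$. A probability $\pi\in\mathcal{P}(X\times Z)$ is holonomic (for $\{\tau_x\}$) if $\int g(\tau_x(z))\,d\pi(x,z)=\int g(z)\,d\pi(x,z)$ for all $g\in C(Z)$. For Lipschitz $b:X\times Z\to\mathbb{R}$, $L_{b,\alpha}:C(Z)\to C(Z)$ is $L_{b,\alpha}(u)(z)=\int e^{b(x,z)}u(\tau_x(z))\,d\alpha(x)$. The relative entropy of a holonomic $\pi$ is $$H_\alpha(\pi)=-\sup\Big\{\int b\,d\pi \;:\; b:X\times Z\to\mathbb{R}\text{ Lipschitz},\ L_{b,\alpha}(1)=1\Big\}\in[-\infty,0].$$ Holonomic probabilities on $Y\times W$ for $\{\tau_y\}$, and their entropy $H_\beta$, are defined in the same way with $(Y,W,\beta)$ in place of $(X,Z,\alpha)$. $\Pi(\cdot,\cdot,\tau)$ is the set of $\pi\in\mathcal{P}(X\times Y\times Z\times W)$ whose $(X,Z)$-marginal is holonomic for $\{\tau_x\}$ and whose $(Y,W)$-marginal is holonomic for $\{\tau_y\}$. For such $\pi$, $H_\alpha(\pi)$ denotes $H_\alpha$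 of the $(X,Z)$-marginal and $H_\beta(\pi)$ denotes $H_\beta$ of the $(Y,W)$-marginal. The marginal pressure of a continuous $k:X\times Y\times Z\times W\to\mathbb{R}$ is $$P_{\alpha,\beta}(k)=\sup_{\pi\in\Pi(\cdot,\cdot,\tau)}\int k\,d\pi+H_\alpha(\pi)+H_\beta(\pi).$$ $\Pi(\mu,\nu,\tau)$ is the set of $\pi\in\Pi(\cdot,\cdot,\tau)$ with $X$-marginal $\mu$ and $Y$-marginal $\nu$. Equalities are in the extended reals (values $-\infty$ allowed). *)

(* Defs.v *)
From HB Require Import structures.
From mathcomp Require Import all_boot all_order all_algebra.
From mathcomp Require Import all_classical all_reals all_analysis.

Set Implicit Arguments.
Unset Strict Implicit.
Unset Printing Implicit Defensive.

Import Order.TTheory GRing.Theory Num.Theory.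
Import numFieldNormedType.Exports.

Local Open Scope classical_set_scope.
Local Open Scope ring_scope.

(* Nonempty metric spaces: the base point is only there because measurable
   types are required to be pointed. *)
#[short(type="pmetricType")]
HB.structure Definition PointedMetric (K : numDomainType) :=
  {M of Pointed M & Metric K M}.

(* [T] with its Borel sigma-algebra. On products the open sets are those of
   the product topology. *)
Notation borel T := (g_sigma_algebraType (@open T)).

Notation borel_probability T R := (probability (borel T) R).

Lemma measurable_fun_g_sigma (S T : pointedType) (G : set (set S))
    (H : set (set T)) (f : S -> T) : (forall B, H B -> G (f @^-1` B)) ->
  measurable_fun [set: g_sigma_algebraType G]
    (f : g_sigma_algebraType G -> g_sigma_algebraType H).
Proof.
move=> fHG; apply: (@measurability _ _ (g_sigma_algebraType G)
  (g_sigma_algebraType H) setT f H) => //.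
by move=> _ [B HB <-]; rewrite setTI; apply: sub_sigma_algebra; exact: fHG.
Qed.

Section projections.
Context {R : realType} {X Y Z W : pmetricType R}.

Definition proj_X (p : borel (X * Y * Z * W)%type) : borel X := p.1.1.1.
Definition proj_Y (p : borel (X * Y * Z * W)%type) : borel Y := p.1.1.2.
Definition proj_XZ (p : borel (X * Y * Z * W)%type) : borel (X * Z)%type :=
  (p.1.1.1, p.1.2).
Definition proj_YW (p : borel (X * Y * Z * W)%type) : borel (Y * W)%type :=
  (p.1.1.2, p.2).

Let c1 : continuous (fun p : X * Y * Z * W => p.1).
Proof. by move=> p; exact: cvg_fst. Qed.

Let c11 : continuous (fun p : X * Y * Z * W => p.1.1).
Proof. by move=> p; apply: (continuous_comp (@c1 p)); exact: cvg_fst. Qed.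

Let cX : continuous (fun p : X * Y * Z * W => p.1.1.1).
Proof. by move=> p; apply: (continuous_comp (@c11 p)); exact: cvg_fst. Qed.

Let cY : continuous (fun p : X * Y * Z * W => p.1.1.2).
Proof. by move=> p; apply: (continuous_comp (@c11 p)); exact: cvg_snd. Qed.

Let cZ : continuous (fun p : X * Y * Z * W => p.1.2).
Proof. by move=> p; apply: (continuous_comp (@c1 p)); exact: cvg_snd. Qed.

Let cW : continuous (fun p : X * Y * Z * W => p.2).
Proof. by move=> p; exact: cvg_snd. Qed.

Let mX : measurable_fun setT proj_X.
Proof. by apply: measurable_fun_g_sigma; apply/continuousP; exact: cX. Qed.

Let mY : measurable_fun setT proj_Y.
Proof. by apply: measurable_fun_g_sigma; apply/continuousP; exact: cY. Qed.

Let mXZ : measurable_fun setT proj_XZ.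
Proof.
apply: measurable_fun_g_sigma; apply/continuousP.
by move=> p; apply: cvg_pair; [exact: cX | exact: cZ].
Qed.

Let mYW : measurable_fun setT proj_YW.
Proof.
apply: measurable_fun_g_sigma; apply/continuousP.
by move=> p; apply: cvg_pair; [exact: cY | exact: cW].
Qed.

HB.instance Definition _ := isMeasurableFun.Build _ _ _ _ proj_X mX.
HB.instance Definition _ := isMeasurableFun.Build _ _ _ _ proj_Y mY.
HB.instance Definition _ := isMeasurableFun.Build _ _ _ _ proj_XZ mXZ.
HB.instance Definition _ := isMeasurableFun.Build _ _ _ _ proj_YW mYW.

End projections.

Section ifs.
Context {R : realType} {X Z : pmetricType R}.
Implicit Types (tau : X -> Z -> Z) (alpha : borel_probability X R).

Definition uniformly_contractive tau := exists2 gamma : R, 0 < gamma < 1 &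
  forall x1 x2 z1 z2,
    mdist (tau x1 z1) (tau x2 z2) <= gamma * (mdist x1 x2 + mdist z1 z2).

Definition full_support alpha :=
  forall U : set X, open U -> U !=set0 -> (0 < alpha U)%E.

(* The metric on [X * Z] is the sum metric, whereas the library's product
   pseudometric is the max one. *)
Definition lipschitz_sum (b : X * Z -> R) := exists K : R,
  forall x1 x2 z1 z2,
    `|b (x1, z1) - b (x2, z2)| <= K * (mdist x1 x2 + mdist z1 z2).

Definition holonomic tau (pi : borel_probability (X * Z)%type R) :=
  forall g : Z -> R, continuous g ->
    (\int[pi]_p (g (tau p.1 p.2))%:E = \int[pi]_p (g p.2)%:E)%E.

Definition transfer tau alpha (b : X * Z -> R) (u : Z -> R) (z : Z) : R :=
  \int[alpha]_x (expR (b (x, z)) * u (tau x z)).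

Definition entropy tau alpha (pi : borel_probability (X * Z)%type R) : \bar R :=
  (- ereal_sup [set \int[pi]_p (b p)%:E | b in
      [set b | lipschitz_sum b /\ transfer tau alpha b (cst 1%R) = cst 1%R]])%E.

End ifs.

Section pressure.
Context {R : realType} {X Y Z W : pmetricType R}.
Variables (tauX : X -> Z -> Z) (tauY : Y -> W -> W).
Variables (alpha : borel_probability X R) (beta : borel_probability Y R).
Implicit Types pi : borel_probability (X * Y * Z * W)%type R.

Definition holonomic_plans : set (borel_probability (X * Y * Z * W)%type R) :=
  [set pi | holonomic tauX (distribution pi proj_XZ) /\
            holonomic tauY (distribution pi proj_YW)].

(* Measures are compared on measurable sets only: as functions on sets they
   are unconstrained elsewhere. *)
Definition holonomic_couplings
    (mu : borel_probability X R) (nu : borel_probability Y R) :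
    set (borel_probability (X * Y * Z * W)%type R) :=
  [set pi | [/\ holonomic_plans pi,
    (forall A : set (borel X), measurable A -> distribution pi proj_X A = mu A) &
    (forall B : set (borel Y), measurable B -> distribution pi proj_Y B = nu B)]].

Definition entropic_value (k : X * Y * Z * W -> R) pi : \bar R :=
  (\int[pi]_p (k p)%:E + entropy tauX alpha (distribution pi proj_XZ)
                       + entropy tauY beta (distribution pi proj_YW))%E.

Definition marginal_pressure (k : X * Y * Z * W -> R) : \bar R :=
  ereal_sup [set entropic_value k pi | pi in holonomic_plans].

End pressure.

(* Main.v *)
Require Import Defs.
From HB Require Import structures.
From mathcomp Require Import all_boot all_order all_algebra.
From mathcomp Require Import all_classical all_reals all_analysis.
From mathcomp Require Import finmap measurable_realfun ring lra.

Set Implicit Arguments.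
Unset Strict Implicit.
Unset Printing Implicit Defensive.

Import Order.TTheory GRing.Theory Num.Theory.
Import numFieldNormedType.Exports.

Local Open Scope classical_set_scope.
Local Open Scope ring_scope.

(* Kantorovich duality by a minimax argument. Replacing the constraint
   L_b(1) = 1 by L_b(1) <= 1 does not change the entropy, because b may be
   replaced by b - ln L_b(1) >= b, and it makes the set of admissible b convex.
   If the supremum is smaller than a real d, itself smaller than the infimum,
   then every function
     c - d - (phi - int phi dmu) - (psi - int psi dnu) - b1 - b2
       - (g1 o tauX - g1) - (g2 o tauY - g2)
   is nonnegative somewhere: otherwise the pressure of c - phi - psi, a finite
   number that can be absorbed in phi, would be at most
   d - int phi dmu - int psi dnu. These functions form a convex subset of C(S),
   where S = X * Y * Z * W, so by Hahn-Banach and Riesz a single probability pi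
   on S integrates all of them to a nonnegative number. Hence pi has marginals
   mu and nu, is holonomic, and has value at least d, a contradiction. The same
   argument without marginals shows that the pressure is finite. *)

(** * Linear functionals below a sublinear one *)

Section sublinear.
Context {R : realType} {V : lmodType R} (D : set V).
Hypotheses (D0 : D 0) (DD : forall x y, D x -> D y -> D (x + y)).
Hypothesis DZ : forall a x, D x -> D (a *: x).

(** [D] is a linear subspace of [V], later the continuous functions among all functions. Homogeneity
    is only an inequality for [a > 0]: the reverse one follows by scaling with [a^-1]. *)
Definition sublinear_on (q : V -> R) :=
  (forall x y, D x -> D y -> q (x + y) <= q x + q y) /\
  (forall a x, 0 < a -> D x -> q (a *: x) <= a * q x).

Lemma sublinear_on0 q : sublinear_on q -> q 0 = 0.
Proof.
move=> [qD qZ]; have := qD 0 0 D0 D0; have := qZ 2^-1 0.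
by rewrite scaler0 addr0 invr_gt0 ltr0n => /(_ isT D0) ? ?; lra.
Qed.

Lemma sublinear_on_ge q x : sublinear_on q -> D x -> - q (- x) <= q x.
Proof.
move=> sq Dx; have := sq.1 x (- x) Dx.
rewrite subrr (sublinear_on0 sq) -scaleN1r => /(_ (DZ _ Dx)); lra.
Qed.

(* A minimal sublinear functional [q] is linear: for each [y],
   [z |-> inf_(t >= 0) (q (z + t y) - t q y)] is sublinear and below [q], hence
   equal to it, so that [q (x + y) >= q x + q y]. *)
Lemma linear_below_sublinear p : sublinear_on p ->
  exists2 l : V -> R,
    (forall x y, D x -> D y -> l (x + y) = l x + l y) /\
    (forall a x, D x -> l (a *: x) = a * l x) &
    forall x, D x -> l x <= p x.
Proof.
move=> sp.
pose T := {q : V -> R | sublinear_on q /\ forall x, D x -> q x <= p x}.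
(* The order is reversed, so that the maximal element given by Zorn's lemma is a minimal sublinear
   functional. *)
pose le_T (q r : T) := `[< forall x, D x -> sval r x <= sval q x >].
have lbp (q : T) x : D x -> - p (- x) <= sval q x.
  move=> Dx; case: q => q [sq qp] /=; apply: le_trans (sublinear_on_ge sq Dx).
  by rewrite lerN2; apply: qp; rewrite -scaleN1r; exact: DZ.
have DN x : D x -> D (- x) by move=> Dx; rewrite -scaleN1r; exact: DZ.
have [||A chA|[q [sq qp]] qmin] :=
  @ZL_preorder T (exist _ p (conj sp (fun x _ => lexx _))) le_T.
- by move=> t; apply/asboolP.
- move=> r s t /asboolP rs /asboolP st; apply/asboolP => x Dx.
  exact: le_trans (st _ Dx) (rs _ Dx).
(* The empty chain is bounded by [p] itself, a nonempty one by its pointwise infimum [r]. *)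
- have [[q0 Aq0]|A0] := pselect (A !=set0); last first.
    exists (exist _ p (conj sp (fun x _ => lexx _))) => s As.
    by exfalso; apply: A0; exists s.
  pose B x := [set sval q x | q in A]; pose r x := inf (B x).
  have hB x : D x -> has_inf (B x).
    move=> Dx; split; first by exists (sval q0 x), q0.
    by exists (- p (- x)) => _ [q _ <-]; exact: lbp.
  have rle q x : D x -> A q -> r x <= sval q x.
    by move=> Dx Aq; apply: ge_inf; [case: (hB _ Dx) | exists q].
  have sr : sublinear_on r.
    split=> [x y Dx Dy|a x a0 Dx].
      apply/ler_addgt0Pr => e e0.
      have e20 : 0 < e / 2 by rewrite divr_gt0.
      have [_ [q Aq <-] qx] := inf_adherent e20 (hB _ Dx).
      have [_ [q' Aq' <-] qy] := inf_adherent e20 (hB _ Dy).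
      rewrite -/(r x) -/(r y) in qx qy.
      have Dxy := DD Dx Dy.
      (* [q] is nearly optimal at [x] and [q'] at [y]; the smaller of the two in the chain is nearly
         optimal at both points. *)
      case: (chA _ _ Aq Aq') => /asboolP le_qq'.
        have := rle _ _ Dxy Aq'; have := le_qq' _ Dx.
        have := (svalP q').1.1 x y Dx Dy; lra.
      have := rle _ _ Dxy Aq; have := le_qq' _ Dy.
      have := (svalP q).1.1 x y Dx Dy; lra.
    rewrite -ler_pdivrMl//; apply: lb_le_inf; first by case: (hB _ Dx).
    move=> _ [q Aq <-]; rewrite ler_pdivrMl//.
    exact: le_trans (rle _ _ (DZ _ Dx) Aq) ((svalP q).1.2 _ _ a0 Dx).
  have rp x : D x -> r x <= p x.
    by move=> Dx; exact: le_trans (rle _ _ Dx Aq0) ((svalP q0).2 _ Dx).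
  exists (exist _ r (conj sr rp)) => s As; apply/asboolP => x Dx /=.
  exact: rle.
have q0 := sublinear_on0 sq.
have qZ a x : 0 < a -> D x -> q (a *: x) = a * q x.
  move=> a0 Dx; apply/eqP; rewrite eq_le sq.2//= -ler_pdivlMl//.
  rewrite -[in leLHS](scale1r x) -(mulVf (lt0r_neq0 a0)) -scalerA.
  by apply: sq.2; rewrite ?invr_gt0//; exact: DZ.
have qD x y : D x -> D y -> q (x + y) = q x + q y.
  move=> Dx Dy; apply/eqP; rewrite eq_le sq.1//=.
  pose B z := [set q (z + t *: y) - t * q y | t in [set t | 0 <= t]].
  pose r z := inf (B z).
  have hB z : D z -> has_inf (B z).
    move=> Dz; split; first by exists (q (z + 0 *: y) - 0 * q y), 0 => /=.
    (* Lower bound: [q (z + t y) + q (- z) >= q (t y) = t q y]. *)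
    exists (- q (- z)) => _ [t /= t0 <-].
    have := sq.1 (z + t *: y) (- z) (DD Dz (DZ _ Dy)) (DN _ Dz).
    rewrite addrAC subrr add0r; have [->|t_neq0] := eqVneq t 0.
      rewrite scale0r addr0 q0; lra.
    rewrite qZ ?lt_neqAle 1?eq_sym ?t_neq0//; lra.
  have rle z t : D z -> 0 <= t -> r z <= q (z + t *: y) - t * q y.
    by move=> Dz t0; apply: ge_inf; [case: (hB _ Dz) | exists t].
  have sr : sublinear_on r.
    split=> [u v Du Dv|a u a0 Du].
      apply/ler_addgt0Pr => e e0.
      have e20 : 0 < e / 2 by rewrite divr_gt0.
      have [_ [t t0 <-] qu] := inf_adherent e20 (hB _ Du).
      have [_ [s s0 <-] qv] := inf_adherent e20 (hB _ Dv).
      rewrite -/(r u) -/(r v) /= in t0 s0 qu qv.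
      have := rle _ (t + s) (DD Du Dv) (addr_ge0 t0 s0).
      have := sq.1 _ _ (DD Du (DZ t Dy)) (DD Dv (DZ s Dy)).
      by rewrite scalerDl addrACA mulrDl; lra.
    rewrite -ler_pdivrMl//; apply: lb_le_inf; first by case: (hB _ Du).
    move=> _ [t t0 <-]; rewrite ler_pdivrMl//.
    apply: le_trans (rle _ (a * t) (DZ _ Du) _) _.
      by rewrite mulr_ge0// ltW.
    by rewrite -scalerA -scalerDr qZ ?mulrBr ?mulrA//; exact/DD/DZ.
  have rq z : D z -> r z <= q z.
    move=> Dz; apply: le_trans (rle _ 0 Dz (lexx _)) _.
    by rewrite scale0r addr0 mul0r subr0.
  have rp z : D z -> r z <= p z.
    by move=> Dz; exact: le_trans (rq _ Dz) (qp _ Dz).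
  have /(_ _)/asboolP/= := qmin (exist _ r (conj sr rp)).
  move=> /(_ (asboolT rq)) /(_ _ Dx) qr.
  (* The value [t = 1] gives [r x <= q (x + y) - q y], while minimality gives [q x <= r x]. *)
  have := rle x 1 Dx ler01; rewrite scale1r; lra.
have qN x : D x -> q (- x) = - q x.
  by move=> Dx; have := qD _ _ Dx (DN _ Dx); rewrite subrr q0; lra.
exists q => //; split=> // a x Dx.
have [a0|a0|->] := ltgtP a 0; last by rewrite scale0r q0 mul0r.
- rewrite -[in LHS](opprK a) scaleNr qN; last exact: DZ.
  by rewrite qZ ?oppr_gt0// mulNr opprK.
- exact: qZ.
Qed.

End sublinear.

(** * Continuous functions on a compact pseudometric space *)

(** Joins the pointed and pseudometric structures on products, so that the results on
    [pseudoPMetricType] apply to [X * Y * Z * W]. *)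
HB.instance Definition _ (R : realType) (X Y : pseudoPMetricType R) :=
  PseudoMetric.on (X * Y)%type.

Section continuous_functions.
Context {R : realType} {S : pseudoPMetricType R}.
Implicit Types (f : S -> R) (U : set S).

Lemma borel_open U : open U -> measurable (U : set (borel S)).
Proof. exact: sub_sigma_algebra. Qed.

Lemma continuous_measurable f : continuous f ->
  measurable_fun [set: borel S] (f : borel S -> R).
Proof.
move=> /continuousP cf.
apply: (measurability _ (RGenOpens.measurableE R)).
move=> _ [_ [a [b ->] <-]]; rewrite setTI; apply: borel_open; apply: cf.
exact: interval_open.
Qed.

(** The function is the distance to the complement of [U] truncated at 1, written as a supremum of
    radii of balls inside [U]; the triangle inequality makes it 1-Lipschitz. *)
Lemma open_cozero U : open U -> exists h : S -> R,
  [/\ continuous h, forall x, 0 <= h x <= 1 & forall x, U x <-> 0 < h x].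
Proof.
move=> oU.
(* The guard [0 < r] keeps 0 in [B x] for every [x], so the supremum is over a nonempty set even
   outside [U]. *)
pose B x := [set r : R | 0 <= r <= 1 /\ (0 < r -> ball x r `<=` U)].
have B0 x : B x 0 by split; rewrite ?lexx ?ler01// ltxx.
have hB x : has_sup (B x).
  by split; [exists 0 | exists 1 => r [/andP[]]].
pose h x := sup (B x).
have leh x r : B x r -> r <= h x by apply: ub_le_sup; case: (hB x).
have geh x y : ubound (B x) y -> h x <= y by apply: ge_sup; case: (hB x).
have h01 x : 0 <= h x <= 1.
  apply/andP; split; first exact: (leh _ _ (B0 x)).
  by apply: geh => r [/andP[]].
have hlip x y (e : R) : 0 < e -> ball x e y -> h x - e <= h y.
  move=> e0 xy; rewrite lerBlDr; apply: geh => r [/andP[r0 r1] rU].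
  rewrite -lerBlDr; have [re|re] := leP (r - e) 0.
    by apply: le_trans re _; case/andP: (h01 y).
  apply: leh; split=> [|_ z yz].
    by rewrite (ltW re)/= lerBlDr (le_trans r1)// lerDl ltW.
  apply: rU; first by rewrite (lt_trans e0)// -subr_gt0.
  by have := ball_triangle xy yz; rewrite addrC subrK.
exists h; split=> // x.
- apply/cvgrPdist_le => e e0; near=> y.
  have xy : ball x e y by near: y; exact: nbhsx_ballx.
  rewrite ler_norml; have := hlip _ _ _ e0 xy.
  have := hlip _ _ _ e0 (ball_sym xy); lra.
- split=> [Ux|h0].
    have [e /= e0 xe] : nbhs_ball x U by apply/nbhs_ballP; exact: open_nbhs_nbhs.
    have e1 : 0 < Num.min e 1 by rewrite lt_min e0 ltr01.
    apply: (lt_le_trans e1); apply: leh; split=> [|_].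
      by rewrite (ltW e1)/= ge_min lexx orbT.
    by apply: subset_trans xe; apply: le_ball; rewrite ge_min lexx.
  have [//|r [_ rU] r0] := sup_gt _ h0; first by case: (hB x).
  exact/(rU r0)/ballxx.
Unshelve. all: by end_near. Qed.

Hypothesis cS : compact [set: S].

(** The largest index of a finite subcover works. This turns a pointwise bound into a uniform one,
    as in Dini's theorem. *)
Lemma compact_nondecreasing_cover (O : nat -> set S) : (forall n, open (O n)) ->
  {homo O : m n / (m <= n)%N >-> m `<=` n} -> (forall x, exists n, O n x) ->
  exists n, forall x, O n x.
Proof.
move=> oO Omon Ocov; have := cS; rewrite compact_cover.
move=> /(_ nat setT O (fun n _ => oO n))[x _|D _ DS].
  by have [n Onx] := Ocov x; exists n.
exists (\max_(i <- enum_fset D) i)%N => x; have [n Dn Onx] := DS x I.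
by apply: Omon Onx; apply: leq_bigmax_seq.
Qed.

Lemma continuous_compact_bound f : continuous f -> exists M, forall x, `|f x| <= M.
Proof.
move=> cf.
have [|||x _ fx] := @compact_EVT_max S R (fun x => `|f x|) setT.
- by exists point.
- exact: cS.
- apply: continuous_subspaceT => x; apply: continuous_comp; first exact: cf.
  exact: norm_continuous.
by exists `|f x| => y; exact/fx/mem_set.
Qed.

Lemma continuous_integrable (m : borel_probability S R) f : continuous f ->
  m.-integrable setT (EFin \o f).
Proof.
move=> cf; apply: measurable_bounded_integrable => //.
- by apply: (le_lt_trans (probability_le1 m measurableT)); rewrite ltry.
- exact: continuous_measurable.
- have [M fM] := continuous_compact_bound cf.
  exists M; split; first exact: num_real.
  by move=> N MN x _ /=; exact/(le_trans (fM x))/ltW.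
Qed.

Lemma continuous_integralE (m : borel_probability S R) f : continuous f ->
  (\int[m]_x (f x)%:E)%E = (\int[m]_x f x)%:E.
Proof.
move=> cf; rewrite fineK//; apply: integrable_fin_num => //.
exact: continuous_integrable.
Qed.

Lemma continuous_RintegralD (m : borel_probability S R) f g :
  continuous f -> continuous g ->
  \int[m]_x (f x + g x) = \int[m]_x f x + \int[m]_x g x.
Proof. by move=> cf cg; apply: RintegralD => //; exact: continuous_integrable. Qed.

Lemma continuous_RintegralB (m : borel_probability S R) f g :
  continuous f -> continuous g ->
  \int[m]_x (f x - g x) = \int[m]_x f x - \int[m]_x g x.
Proof. by move=> cf cg; apply: RintegralB => //; exact: continuous_integrable. Qed.

Lemma continuous_RintegralZ (m : borel_probability S R) a f : continuous f ->
  \int[m]_x (a * f x) = a * \int[m]_x f x.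
Proof. by move=> cf; apply: RintegralZl => //; exact: continuous_integrable. Qed.

Lemma probability_Rintegral_cst (m : borel_probability S R) a :
  \int[m]_x a = a.
Proof.
rewrite Rintegral_cst// -[RHS]mulr1 -[X in _ = _ * X]/(fine 1%E).
by congr (_ * fine _); exact: probability_setT.
Qed.

Lemma continuous_Rintegral_le (m : borel_probability S R) f g :
  continuous f -> continuous g -> (forall x, f x <= g x) ->
  \int[m]_x f x <= \int[m]_x g x.
Proof.
by move=> cf cg fg; apply: le_Rintegral => //; exact: continuous_integrable.
Qed.

End continuous_functions.

(** * Continuity of pointwise operations *)

Section continuous_operations.
Context {R : realType} {S : topologicalType}.
Implicit Types (f g : S -> R) (a : R).

Lemma continuousD_fun f g : continuous f -> continuous g ->
  continuous (fun x => f x + g x).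
Proof. by move=> cf cg x; apply: cvgD; [exact: cf | exact: cg]. Qed.

Lemma continuousN_fun f : continuous f -> continuous (fun x => - f x).
Proof. by move=> cf x; apply: cvgN; exact: cf. Qed.

Lemma continuousB_fun f g : continuous f -> continuous g ->
  continuous (fun x => f x - g x).
Proof. by move=> cf cg; apply: continuousD_fun => //; exact: continuousN_fun. Qed.

Lemma continuousM_fun f g : continuous f -> continuous g ->
  continuous (fun x => f x * g x).
Proof. by move=> cf cg x; apply: cvgM; [exact: cf | exact: cg]. Qed.

Lemma continuous_cst_fun a : continuous (fun _ : S => a).
Proof. by move=> x; exact: cvg_cst. Qed.

Lemma continuousZ_fun a f : continuous f -> continuous (fun x => a * f x).
Proof. by move=> cf; apply: continuousM_fun => //; exact: continuous_cst_fun. Qed.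

Lemma continuous_min_fun f g : continuous f -> continuous g ->
  continuous (fun x => Num.min (f x) (g x)).
Proof. by move=> cf cg x; apply: continuous_min; [exact: cf | exact: cg]. Qed.

Lemma continuous_max_fun f g : continuous f -> continuous g ->
  continuous (fun x => Num.max (f x) (g x)).
Proof. by move=> cf cg x; apply: continuous_max; [exact: cf | exact: cg]. Qed.

Lemma continuous_sum_fun n (f : nat -> S -> R) : (forall i, continuous (f i)) ->
  continuous (fun x => \sum_(i < n) f i x).
Proof.
move=> cf; elim: n => [|n IHn].
  by under eq_fun do rewrite big_ord0; exact: continuous_cst_fun.
by under eq_fun do rewrite big_ord_recr/=; exact: continuousD_fun.
Qed.

Lemma open_lt_fun f g : continuous f -> continuous g -> open [set x | f x < g x].
Proof.
move=> cf cg; rewrite (_ : mkset _ = (fun x => g x - f x) @^-1` [set y | 0 < y]).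
  by apply: open_comp; [move=> x _; exact: continuousB_fun | exact: open_gt].
by apply/seteqP; split=> x /=; rewrite subr_gt0.
Qed.

End continuous_operations.

(** * Riesz representation *)

Section riesz.
Context {R : realType} {S : pseudoPMetricType R}.
Hypothesis cS : compact [set: S].
Variable L : (S -> R) -> R.
Implicit Types (f g : S -> R) (U : set S).
Hypothesis LD : forall f g, continuous f -> continuous g -> L (f + g) = L f + L g.
Hypothesis LZ : forall a f, continuous f -> L (a *: f) = a * L f.
Hypothesis L_ge0 : forall f, continuous f -> (forall x, 0 <= f x) -> 0 <= L f.
Hypothesis L1 : L (cst 1) = 1.

Lemma functionalN f : continuous f -> L (- f) = - L f.
Proof. by move=> cf; rewrite -scaleN1r LZ// mulN1r. Qed.

Lemma functional_cst a : L (cst a) = a.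
Proof.
rewrite (_ : cst a = a *: cst 1); last by apply/funext => x; exact/esym/mulr1.
by rewrite LZ ?L1 ?mulr1//; exact: continuous_cst_fun.
Qed.

Lemma functional_le f g : continuous f -> continuous g ->
  (forall x, f x <= g x) -> L f <= L g.
Proof.
move=> cf cg fg; rewrite -subr_ge0 -functionalN// -LD//; last exact: continuousN_fun.
by apply: L_ge0 => [|x]; [exact: continuousB_fun | rewrite subr_ge0].
Qed.

Lemma functional_sum n (f : nat -> S -> R) : (forall i, continuous (f i)) ->
  L (fun x => \sum_(i < n) f i x) = \sum_(i < n) L (f i).
Proof.
move=> cf; elim: n => [|n IHn].
  under eq_fun do rewrite big_ord0; rewrite big_ord0; exact: functional_cst.
under eq_fun do rewrite big_ord_recr/=.
rewrite (LD _ (cf n)); last exact: continuous_sum_fun.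
by rewrite IHn big_ord_recr.
Qed.

(** The value that a measure representing [L] must take on an open set [U]. *)
Definition inner_content U : \bar R := ereal_sup [set (L f)%:E | f in
  [set f : S -> R | continuous f /\ forall x, 0 <= f x <= \1_U x]].

Lemma inner_content_ge U f : continuous f -> (forall x, 0 <= f x <= \1_U x) ->
  ((L f)%:E <= inner_content U)%E.
Proof. by move=> cf fU; apply: ereal_sup_ubound; exists f. Qed.

Lemma inner_content_ge0 U : (0 <= inner_content U)%E.
Proof.
rewrite -[0%E]/(0%:E) -(functional_cst 0); apply: inner_content_ge => [|x].
  exact: continuous_cst_fun.
by rewrite lexx/= indicE ler0n.
Qed.

Lemma inner_content_mono U V : U `<=` V -> (inner_content U <= inner_content V)%E.
Proof.
move=> UV; apply: ereal_sup_le => _ [f [cf fU] <-]; exists f => //; split=> // x.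
case/andP: (fU x) => -> /= /le_trans; apply; rewrite !indicE ler_nat.
by case: (boolP (x \in U)) => // /set_mem/UV/mem_set ->.
Qed.

(** Let [h n] be positive exactly on [U n]. The sums [F N] of the functions [min 1 (N h n)],
    [n < N], increase with [N] and at each point eventually exceed [f - e]; by compactness one [N]
    serves everywhere. Each summand lies below the indicator of [U n], so [L f <= L (F N) + e] gives
    the bound. *)
Lemma inner_content_sigma_subadditive (U : nat -> set S) :
  (forall n, open (U n)) ->
  (inner_content (\bigcup_n U n) <= \sum_(n <oo) inner_content (U n))%E.
Proof.
move=> oU; apply: ge_ereal_sup => _ [f [cf fU] <-]; apply/lee_addgt0Pr => e e0.
have [h hP] := choice (fun n => open_cozero (oU n)).
pose g N n x := Num.min 1 (N%:R * h n x).
have ch n : continuous (h n) by case: (hP n).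
have h0 n x : 0 <= h n x by case: (hP n) => _ /(_ x) /andP[].
have cg N n : continuous (g N n).
  by apply: continuous_min_fun; [exact: continuous_cst_fun | exact: continuousZ_fun].
have g0 N n x : 0 <= g N n x by rewrite /g le_min ler01 mulr_ge0.
pose F N x := \sum_(n < N) g N n x.
have cF N : continuous (F N) by exact: continuous_sum_fun.
have [N fF] : exists N, forall x, f x - e < F N x.
  apply: (compact_nondecreasing_cover cS (O := fun N => [set x | f x - e < F N x])).
  - move=> N; apply: open_lt_fun => //.
    by apply: continuousB_fun => //; exact: continuous_cst_fun.
  - move=> m n mn x /= /lt_le_trans; apply.
    rewrite /F -!(big_mkord xpredT (fun i => g _ i x)) [leRHS](@big_cat_nat _ _ _ m)//=.
    rewrite -[leLHS]addr0 lerD ?sumr_ge0// ler_sum// => i _.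
    by rewrite /g le_min ge_min lexx/= ge_min ler_wpM2r ?orbT// ler_nat.
  - move=> x; have [[n _ Un]|nU] := pselect ((\bigcup_n U n) x); last first.
      exists 0%N; rewrite /= /F big_ord0; case/andP: (fU x) => _.
      rewrite indicE memNset// mulr0n => fx; lra.
    have hx : 0 < h n x by case: (hP n) => _ _ /(_ x) [+ _]; exact.
    pose k := (Num.truncn (h n x)^-1).+1.
    have kh : 1 <= k%:R * h n x.
      by rewrite -ler_pdivrMr// mul1r ltW// truncnS_gt.
    (* This index exceeds [n], so the [n]-th term occurs in the sum, and it is at least [k], so that
       term equals 1. *)
    exists (n.+1 + k)%N => /=; rewrite ltrBlDr.
    apply: le_lt_trans (_ : 1 < _ + e).
      by case/andP: (fU x) => _ /le_trans; apply; rewrite indicE lern1 leq_b1.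
    rewrite (_ : 1 = g (n.+1 + k)%N n x); last first.
      rewrite /g min_l// (le_trans kh)// ler_wpM2r// ler_nat leq_addl.
      by [].
    have n1k : (n < n.+1 + k)%N by rewrite ltn_addr.
    rewrite /F (bigD1 (Ordinal n1k))//= -addrA ltrDl.
    by rewrite ltr_wpDl// sumr_ge0.
have Lf : L f <= L (F N) + e.
  rewrite -[e in leRHS]functional_cst -LD//; last exact: continuous_cst_fun.
  apply: functional_le => // [|x].
    by apply: continuousD_fun => //; exact: continuous_cst_fun.
  by rewrite fctE/= -lerBlDr ltW.
apply: le_trans (_ : ((L (F N))%:E + e%:E <= _)%E); first by rewrite -EFinD lee_fin.
apply: leeD => //; rewrite /F functional_sum// -sumEFin.
apply: le_trans (nneseries_lim_ge N _); last by move=> *; exact: inner_content_ge0.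
rewrite big_mkord; apply: lee_sum => i _; apply: inner_content_ge => // x.
rewrite g0/= indicE; case: (boolP (x \in U i)) => [_|xU]; first by rewrite ge_min lexx.
rewrite /g; suff -> : h i x = 0 by rewrite mulr0 ge_min lexx orbT.
apply/eqP; rewrite eq_le h0 andbT leNgt; apply/negP.
by case: (hP i) => _ _ /(_ x) [_ h_U] /h_U /mem_set; rewrite (negbTE xU).
Qed.

(** Outer regularity serves as the definition on arbitrary sets; Caratheodory's construction then
    yields the measure. *)
Definition outer_content (A : set S) : \bar R :=
  ereal_inf [set inner_content U | U in [set U : set S | open U /\ A `<=` U]].

Lemma inner_content_le1 U : (inner_content U <= 1)%E.
Proof.
apply: ge_ereal_sup => _ [f [cf fU] <-]; rewrite lee_fin -[leRHS](functional_cst 1).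
apply: functional_le => [//||x]; first exact: continuous_cst_fun.
by case/andP: (fU x) => _ /le_trans; apply; rewrite indicE lern1 leq_b1.
Qed.

Lemma outer_content_ge0 A : (0 <= outer_content A)%E.
Proof.
by apply: le_ereal_inf_tmp => _ [U _ <-]; exact: inner_content_ge0.
Qed.

Lemma outer_content_le A U : open U -> A `<=` U ->
  (outer_content A <= inner_content U)%E.
Proof. by move=> oU AU; apply: ereal_inf_lbound; exists U. Qed.

Lemma outer_content_open U : open U -> outer_content U = inner_content U.
Proof.
move=> oU; apply/eqP; rewrite eq_le outer_content_le//=.
by apply: le_ereal_inf_tmp => _ [V [oV UV] <-]; exact: inner_content_mono.
Qed.

Lemma outer_content_fin_num A : outer_content A \is a fin_num.
Proof.
rewrite ge0_fin_numE ?outer_content_ge0//.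
apply: le_lt_trans (outer_content_le openT (@subsetT _ _)) _.
exact: le_lt_trans (inner_content_le1 _) (ltry 1).
Qed.

Lemma outer_content0 : outer_content set0 = 0%E.
Proof.
rewrite outer_content_open; last exact: open0.
apply/eqP; rewrite eq_le inner_content_ge0 andbT.
apply: ge_ereal_sup => _ [f [cf fU] <-]; rewrite (_ : f = cst 0) ?functional_cst//.
by apply/funext => x; apply/eqP; have := fU x; rewrite indic0 eq_le andbC.
Qed.

Lemma outer_content_subset_sigma_subadditive A (F : nat -> set S) :
  A `<=` \bigcup_n F n -> (outer_content A <= \sum_(n <oo) outer_content (F n))%E.
Proof.
move=> AF; apply/lee_addgt0Pr => e e0.
have /choice[U UP] n : exists U, [/\ open U, F n `<=` U &
    (inner_content U <= outer_content (F n) + (e / (2 ^ n.+1)%:R)%:E)%E].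
  have e2 : 0 < e / (2 ^ n.+1)%:R by rewrite divr_gt0// ltr0n expn_gt0.
  have [_ [U [oU FU] <-] /ltW UF] :=
    lb_ereal_inf_adherent e2 (outer_content_fin_num (F n)).
  by exists U.
have oU : open (\bigcup_n U n) by apply: bigcup_open => n _; case: (UP n).
have AU : A `<=` \bigcup_n U n.
  by move=> x /AF[n _ Fx]; exists n => //; case: (UP n) => _ + _; exact.
apply: le_trans (outer_content_le oU AU) _.
apply: le_trans (inner_content_sigma_subadditive _) _.
  by move=> n; case: (UP n).
apply: le_trans (epsilon_trick xpredT _ (ltW e0)) => [|n].
  apply: lee_nneseries => [n _ _|n _]; first exact: inner_content_ge0.
  by case: (UP n).
exact: outer_content_ge0.
Qed.

HB.instance Definition _ := isSubsetOuterMeasure.Build R S outer_content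
  outer_content0 outer_content_ge0
  outer_content_subset_sigma_subadditive.

(** It is enough to split an open [V] containing [A]. Take [f] below the indicator of [V] and [U].
    Off [U] it vanishes, so the rest of [A] lies in the open set [W] where [f < e]. For [g] below
    the indicator of [W], the function [max (f - e) 0 + g] is still below the indicator of [V]. *)
Lemma outer_content_open_caratheodory U : open U -> outer_content.-caratheodory U.
Proof.
move=> oU; apply: le_caratheodory_measurable => A.
apply: le_ereal_inf_tmp => _ [V [oV AV] <-].
apply: (@le_trans _ _ (inner_content (V `&` U) + outer_content (A `&` ~` U))%E).
  by apply: leeD => //; apply: outer_content_le; [exact: openI | exact: setSI].
rewrite -leeBrDr ?outer_content_fin_num//; apply: ge_ereal_sup => _ [f [cf fU] <-].
rewrite leeBrDr ?outer_content_fin_num//; apply/lee_addgt0Pr => e e0.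
pose W := V `&` [set x | f x < e].
have oW : open W.
  by apply: openI => //; apply: open_lt_fun => //; exact: continuous_cst_fun.
have AW : A `&` ~` U `<=` W.
  move=> x [Ax nUx]; split; first exact: AV.
  case/andP: (fU x) => _; rewrite /= indicE memNset ?mulr0n; last by case.
  by move/le_lt_trans; apply.
apply: (@le_trans _ _ ((L f)%:E + inner_content W)%E).
  by apply: leeD => //; exact: outer_content_le.
rewrite -leeBrDl//; apply: ge_ereal_sup => _ [g [cg gW] <-].
(* Truncation costs at most [e] in [L] and makes [f'] vanish on [W], where [g] may be positive. *)
pose f' x := Num.max (f x - e) 0.
have cf' : continuous f'.
  apply: continuous_max_fun; last exact: continuous_cst_fun.
  by apply: continuousB_fun => //; exact: continuous_cst_fun.
have Lf : L f <= L f' + e.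
  rewrite -[e in leRHS]functional_cst -LD//; last exact: continuous_cst_fun.
  apply: functional_le => // [|x].
    by apply: continuousD_fun => //; exact: continuous_cst_fun.
  by rewrite fctE/= -lerBlDr le_max lexx.
have : ((L (f' + g))%:E <= inner_content V)%E.
  apply: inner_content_ge => [|x]; first exact: continuousD_fun.
  have := gW x; have := fU x; rewrite fctE/= /f' /W !indicE !in_setI.
  have -> : (x \in [set y | f y < e]) = (f x < e).
    by apply/idP/idP => [/set_mem|/mem_set].
  rewrite maxEle; case: (x \in V) => /=; last by case: ifP => ?; lra.
  by have [fxe|efx] := ltP (f x) e; case: (x \in U) => /=; case: ifP => ?; lra.
rewrite LD// => LV; rewrite leeBrDl//.
apply: le_trans (leeD LV (lexx e%:E)); rewrite -!EFinD lee_fin; lra.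
Qed.

(** The outer content retyped on [borel S], so that the measure structure refers to the Borel
    sets. *)
Definition riesz_measure (A : set (borel S)) : \bar R := outer_content A.

Lemma borel_caratheodory (A : set (borel S)) :
  measurable A -> outer_content.-caratheodory A.
Proof.
apply: smallest_sub => [|U]; last exact: outer_content_open_caratheodory.
split; first exact: caratheodory_measurable_set0.
- by move=> B mB; rewrite setTD; exact: caratheodory_measurable_setC.
- by move=> B mB; exact: caratheodory_measurable_bigcup.
Qed.

Lemma riesz_measure_sigma_additive : semi_sigma_additive riesz_measure.
Proof.
move=> F mF tF mUF; apply: (@caratheodory_measure_sigma_additive _ _ outer_content).
- by move=> n; exact: borel_caratheodory.
- exact: tF.
- exact: borel_caratheodory.
Qed.

HB.instance Definition _ := isMeasure.Build _ _ _ riesz_measure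
  outer_content0 outer_content_ge0 riesz_measure_sigma_additive.

Lemma riesz_measure_setT : riesz_measure setT = 1%E.
Proof.
rewrite /riesz_measure outer_content_open; last exact: openT.
apply/eqP; rewrite eq_le inner_content_le1/= -[1%E]/(1%:E) -L1.
apply: inner_content_ge => [|x]; first exact: continuous_cst_fun.
by rewrite indicT lexx ler01.
Qed.

HB.instance Definition _ := Measure_isProbability.Build _ _ _ riesz_measure
  riesz_measure_setT.

(** The [i]-th term is the length of the part of [[0, a]] inside [[i, i + 1]]. *)
Lemma sum_minr_maxr n (a : R) : 0 <= a ->
  \sum_(i < n) Num.min (Num.max (a - i%:R) 0) 1 = Num.min a n%:R.
Proof.
move=> a0; elim: n => [|n IHn]; first by rewrite big_ord0 min_r.
rewrite big_ord_recr/= IHn -natr1; have [an|na] := leP a n%:R.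
  by rewrite max_r ?subr_le0// min_l ?ler01// min_l ?addr0//; lra.
rewrite max_l ?subr_ge0 ?(ltW na)// !minEle.
by case: ifP => ?; case: ifP => ?; lra.
Qed.

(** Counting the integers [i < a] overestimates [a] by at most 1. *)
Lemma sum_lt_le n (a : R) : 0 <= a ->
  \sum_(i < n) (i%:R < a)%R%:R <= Num.min (a + 1) n%:R.
Proof.
move=> a0; elim: n => [|n IHn]; first by rewrite big_ord0 min_r//; lra.
rewrite big_ord_recr/= -natr1; move: IHn; rewrite !minEle.
have [na|an] := ltP n%:R a;
  by case: ifP => ?; case: ifP => ?; rewrite /= => ?; lra.
Qed.

Local Notation mu := (riesz_measure : borel_probability S R).

(* Layer cake: [N f] is the sum over [i < N] of the truncations [t i], and
   [t i] is at most the indicator of [{N f > i}]. *)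
Lemma functional_le_integral01 f : continuous f -> (forall x, 0 <= f x <= 1) ->
  L f <= \int[mu]_x f x.
Proof.
move=> cf f01; apply/ler_addgt0Pr => e e0.
(* The count of layers is off by at most 1, that is by [1 / N <= e] after division by [N]. *)
pose N := (Num.truncn e^-1).+1.
have N0 : 0 < N%:R :> R by rewrite ltr0n.
have Ne : N%:R * e >= 1 by rewrite -ler_pdivrMr// mul1r ltW// truncnS_gt.
suff : N%:R * L f <= N%:R * \int[mu]_x f x + 1.
  by move=> H; rewrite -(ler_pM2l N0) mulrDr (le_trans H)// lerD2l.
have cNf : continuous (fun x => N%:R * f x) by exact: continuousZ_fun.
have Nf0 x : 0 <= N%:R * f x by rewrite mulr_ge0//; case/andP: (f01 x).
pose t i x := Num.min (Num.max (N%:R * f x - i%:R) 0) 1.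
have ct i : continuous (t i).
  apply: continuous_min_fun; last exact: continuous_cst_fun.
  apply: continuous_max_fun; last exact: continuous_cst_fun.
  by apply: continuousB_fun => //; exact: continuous_cst_fun.
pose U i := [set x | i%:R < N%:R * f x].
have oU i : open (U i) by apply: open_lt_fun => //; exact: continuous_cst_fun.
have indicU i x : \1_(U i) x = (i%:R < N%:R * f x)%R%:R :> R.
  by rewrite indicE; congr (nat_of_bool _)%:R; apply/idP/idP => [/set_mem|/mem_set].
have -> : N%:R * L f = \sum_(i < N) L (t i).
  rewrite -LZ// -functional_sum//; congr L; apply/funext => x.
  rewrite sum_minr_maxr//; apply/esym/min_l.
  by rewrite -[leRHS]mulr1 ler_wpM2l//; case/andP: (f01 x).
have Lt i : ((L (t i))%:E <= mu (U i))%E.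
  rewrite [leRHS]outer_content_open//; apply: inner_content_ge => // x.
  rewrite indicU /t le_min ler01 le_max lexx orbT/=.
  have [_|ai] := ltP; first by rewrite ge_min lexx orbT.
  by rewrite max_r ?subr_le0// ge_min lexx.
rewrite -lee_fin -sumEFin.
apply: (@le_trans _ _ (\int[mu]_x (\sum_(i < N) \1_(U i) x)%:E)%E).
  under eq_integral do rewrite -sumEFin.
  rewrite ge0_integral_sum//=.
  - apply: lee_sum => i _; rewrite integral_indic ?setIT//; exact: borel_open.
  - by move=> i; apply/measurable_EFinP; apply: measurable_indic; exact: borel_open.
have -> : (N%:R * \int[mu]_x f x + 1)%:E = (\int[mu]_x (N%:R * f x + 1)%:E)%E.
  rewrite continuous_integralE//; last first.
    by apply: continuousD_fun => //; exact: continuous_cst_fun.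
  rewrite continuous_RintegralD//; last exact: continuous_cst_fun.
  by rewrite continuous_RintegralZ// probability_Rintegral_cst.
apply: ge0_le_integral => //.
- by move=> x _; rewrite lee_fin sumr_ge0.
- apply/measurable_EFinP; apply: measurable_sum => i.
  by apply: measurable_indic; exact: borel_open.
- apply/measurable_EFinP; apply: continuous_measurable.
  by apply: continuousD_fun => //; exact: continuous_cst_fun.
move=> x _; rewrite lee_fin; under eq_bigr do rewrite indicU.
by apply: le_trans (sum_lt_le _ _) _ => //; rewrite ge_min lexx.
Qed.

(** Both sides are affine in [f], and [k (f + M)] takes values in [[0, 1]]; the 1 added to [2 M]
    avoids a zero denominator. *)
Lemma functional_le_integral f : continuous f -> L f <= \int[mu]_x f x.
Proof.
move=> cf; have [M fM] := continuous_compact_bound cS cf.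
have M0 : 0 <= M by apply: le_trans (fM point).
pose k := (2 * M + 1)^-1; have k0 : 0 < k by rewrite invr_gt0; lra.
have cMf : continuous (fun x => f x + M).
  by apply: continuousD_fun => //; exact: continuous_cst_fun.
have := @functional_le_integral01 (fun x => k * (f x + M)).
rewrite (LZ k cMf) (LD cf (@continuous_cst_fun _ _ M)) functional_cst.
rewrite continuous_RintegralZ// continuous_RintegralD//; last exact: continuous_cst_fun.
rewrite probability_Rintegral_cst ler_pM2l// lerD2r; apply.
  exact: continuousZ_fun.
move=> x; have := fM x; rewrite ler_norml => /andP[Mf fMx].
rewrite mulr_ge0//=; [|exact: ltW|lra].
by rewrite mulrC ler_pdivrMr; lra.
Qed.

(** The inequality for [- f] is the reverse inequality for [f]. *)
Lemma functional_integral f : continuous f -> \int[mu]_x f x = L f.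
Proof.
move=> cf; apply/eqP; rewrite eq_le functional_le_integral// andbT.
have := functional_le_integral (continuousN_fun cf).
rewrite functionalN// (_ : (fun x => - f x) = (fun x => -1 * f x)).
  by rewrite continuous_RintegralZ// mulN1r lerN2.
by apply/funext => x; rewrite mulN1r.
Qed.

End riesz.

Theorem riesz_representation {R : realType} {S : pseudoPMetricType R}
    (L : (S -> R) -> R) : compact [set: S] ->
  (forall f g : S -> R, continuous f -> continuous g -> L (f + g) = L f + L g) ->
  (forall a (f : S -> R), continuous f -> L (a *: f) = a * L f) ->
  (forall f : S -> R, continuous f -> (forall x, 0 <= f x) -> 0 <= L f) ->
  L (cst 1) = 1 ->
  exists P : borel_probability S R,
    forall f : S -> R, continuous f -> \int[P]_x f x = L f.
Proof.
move=> cS LD LZ L0 L1; eexists => f cf.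
exact: (functional_integral cS LD LZ L0 L1 cf).
Qed.

(** * Minimax *)

Lemma cvg_min1_indic {R : realType} (a : R) : 0 <= a ->
  (Num.min 1 (n%:R * a))%:E @[n --> \oo] --> ((0 < a)%R%:R : R)%:E.
Proof.
rewrite le_eqVlt => /predU1P[<-|a0].
  rewrite ltxx mulr0n; apply: cvg_near_cst; apply: nearW => n.
  by rewrite mulr0 min_r ?ler01.
rewrite a0 mulr1n; apply: cvg_near_cst; near=> n; rewrite min_l//.
rewrite -ler_pdivrMr// mul1r; near: n; exact: nbhs_infty_ger.
Unshelve. all: by end_near. Qed.

(** The indicator of an open set is the increasing limit of the continuous functions [min 1 (n h)],
    so [P] and [Q] agree on open sets by monotone convergence. Open sets are stable under
    intersection and generate the Borel sets. *)
Lemma borel_probability_eq {R : realType} {S : pseudoPMetricType R}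
    (cS : compact [set: S]) (P Q : borel_probability S R) :
  (forall f : S -> R, continuous f -> \int[P]_x f x = \int[Q]_x f x) ->
  forall A : set (borel S), measurable A -> P A = Q A.
Proof.
move=> PQ.
have PQU (U : set S) : open U -> P U = Q U.
  move=> oU; have [h [ch h01 hU]] := open_cozero oU.
  have h0 x : 0 <= h x by case/andP: (h01 x).
  pose g (n : nat) (x : S) := Num.min 1 (n%:R * h x).
  have cg n : continuous (g n).
    by apply: continuous_min_fun; [exact: continuous_cst_fun | exact: continuousZ_fun].
  suff m_lim (m : borel_probability S R) : m U = limn (fun n => (\int[m]_x g n x)%:E).
    by rewrite !m_lim; congr (limn _); apply/funext => n; rewrite PQ.
  have mU : measurable (U : set (borel S)) by exact: borel_open.
  rewrite -[U in LHS]setIT -(integral_indic m measurableT mU).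
  have -> : (fun n => (\int[m]_x g n x)%:E) = (fun n => \int[m]_x (g n x)%:E)%E.
    by apply/funext => n; rewrite continuous_integralE.
  rewrite -monotone_convergence//=.
  - apply: eq_integral => x _; apply/esym/cvg_lim => //.
    rewrite indicE (_ : (x \in U) = (0 < h x)); first exact: cvg_min1_indic.
    by apply/idP/idP => [/set_mem/hU|/hU/mem_set].
  - by move=> n; apply/measurable_EFinP; exact: continuous_measurable.
  - by move=> n x _; rewrite lee_fin le_min ler01 mulr_ge0.
  - move=> x _ m' n mn; rewrite lee_fin le_min ge_min lexx/= ge_min.
    by rewrite ler_wpM2r ?orbT// ler_nat.
move=> A mA; apply: (@measure_unique _ R (borel S) (@open S) (fun=> setT) _ _ _ _ P Q)
  => //.
- by move=> U V oU oV; exact: openI.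
- by move=> _; exact: openT.
- by rewrite bigcup_const.
- by move=> _; rewrite (le_lt_trans (probability_le1 P measurableT))// ltry.
Qed.

(* The sublinear functional [p h] is the least [M] such that [h + t f <= M]
   everywhere for some [f] in [G] and [t >= 0]: below [p], a linear functional
   is positive, of mass one, and nonnegative on [G]. *)
Lemma minimax_probability {R : realType} {S : pseudoPMetricType R}
    (cS : compact [set: S]) (G : set (S -> R)) :
  G !=set0 -> (forall f, G f -> continuous f) ->
  (forall f g a b, G f -> G g -> 0 <= a -> 0 <= b -> a + b = 1 ->
    G (fun s => a * f s + b * g s)) ->
  (forall f, G f -> exists s, 0 <= f s) ->
  exists P : borel_probability S R, forall f, G f -> 0 <= \int[P]_s f s.
Proof.
move=> [f0 Gf0] Gc Gconvex Gnneg.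
pose B (h : S -> R) := [set M : R | exists t f, [/\ 0 <= t, G f &
  forall s, h s + t * f s <= M]].
pose p h := inf (B h).
have hB h : continuous h -> has_inf (B h).
  move=> ch; have [M hM] := continuous_compact_bound cS ch; split.
    exists M, 0, f0; split=> // s; rewrite mul0r addr0.
    exact: le_trans (ler_norm _) (hM s).
  (* At a point where [f] is nonnegative, [h + t f] is at least [h]; this is where the hypothesis on
     [G] makes [p] finite. *)
  exists (- M) => N [t [f [t0 Gf hfN]]]; have [s fs] := Gnneg _ Gf.
  apply: le_trans (hfN s); have := hM s; rewrite ler_norml => /andP[+ _].
  by move=> /le_trans; apply; rewrite lerDl mulr_ge0.
have ple h t f M : continuous h -> 0 <= t -> G f ->
    (forall s, h s + t * f s <= M) -> p h <= M.
  by move=> ch t0 Gf hM; apply: ge_inf; [case: (hB _ ch) | exists t, f].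
pose D : set (S -> R) := [set h | continuous h].
have D0 : D 0 by exact: continuous_cst_fun.
have DD h k : D h -> D k -> D (h + k) by exact: continuousD_fun.
have DZ a h : D h -> D (a *: h) by exact: continuousZ_fun.
have sp : sublinear_on D p.
  split=> [h k Dh Dk|a h a0 Dh].
    apply/ler_addgt0Pr => e e0; have e20 : 0 < e / 2 by rewrite divr_gt0.
    have [M [t [f [t0 Gf hM]]]] := inf_adherent e20 (hB _ Dh).
    have [N [u [g [u0 Gg kN]]]] := inf_adherent e20 (hB _ Dk).
    rewrite -/(p h) -/(p k) => kN' hM'.
    suff : p (h + k) <= M + N by lra.
    (* The two witnesses are merged with weights [t / (t + u)] and [u / (t + u)], so [t = u = 0] is
       treated apart. *)
    have := addr_ge0 t0 u0; rewrite le_eqVlt => /predU1P[/esym/eqP|tu0].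
      rewrite paddr_eq0// => /andP[/eqP tE /eqP uE].
      apply: (ple _ 0 f) => // [|s]; first exact: DD.
      have := hM s; have := kN s; rewrite tE uE fctE !mul0r; lra.
    have Gfg : G (fun s => t / (t + u) * f s + u / (t + u) * g s).
      apply: Gconvex => //; rewrite ?divr_ge0 ?(ltW tu0)//.
      by rewrite -mulrDl mulfV// lt0r_neq0.
    apply: (ple _ (t + u) _ _ _ (ltW tu0) Gfg) => [|s]; first exact: DD.
    rewrite (_ : (t + u) * _ = t * f s + u * g s).
      by rewrite fctE; have := hM s; have := kN s; lra.
    by field; rewrite lt0r_neq0.
  rewrite -ler_pdivrMl//; apply: lb_le_inf; first by case: (hB _ Dh).
  move=> M [t [f [t0 Gf hM]]]; rewrite ler_pdivrMl//.
  apply: (ple _ (a * t) f) => // [||s]; first exact: DZ.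
    by rewrite mulr_ge0// ltW.
  by rewrite -mulrA -[(a *: h) s]/(a * h s) -mulrDr ler_pM2l.
have [L [LD LZ] Lp] := linear_below_sublinear D0 DD DZ sp.
have LN h : D h -> L (- h) = - L h by move=> Dh; rewrite -scaleN1r LZ// mulN1r.
have DN h : D h -> D (- h) by exact: continuousN_fun.
have L0 (f : S -> R) : continuous f -> (forall x, 0 <= f x) -> 0 <= L f.
  move=> cf f_ge0; rewrite -oppr_le0 -LN//; apply: le_trans (Lp _ (DN _ cf)) _.
  by apply: (ple _ 0 f0) => // [|s]; [exact: DN | rewrite mul0r addr0 oppr_le0].
have D1 : D (cst 1) by exact: continuous_cst_fun.
have L1 : L (cst 1) = 1.
  apply/eqP; rewrite eq_le; apply/andP; split.
    apply: le_trans (Lp _ D1) _.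
    by apply: (ple _ 0 f0) => // s; rewrite mul0r addr0.
  rewrite -lerN2 -LN//; apply: le_trans (Lp _ (DN _ D1)) _.
  by apply: (ple _ 0 f0) => // [|s]; [exact: DN | rewrite mul0r addr0].
have [P PL] := riesz_representation cS LD LZ L0 L1.
exists P => f Gf; have cf := Gc _ Gf; rewrite PL// -oppr_le0 -LN//.
apply: le_trans (Lp _ (DN _ cf)) _.
(* With [t = 1], the function [- f + f = 0] is bounded by 0, so [p (- f) <= 0]. *)
by apply: (ple _ 1 f) => // [|s]; [exact: DN | rewrite mul1r addNr].
Qed.

(** * Subnormal potentials and entropy *)

Section product_space.
Context {R : realType} {X Z : pmetricType R}.

(** The conclusion is in terms of balls of a general [T], so that it covers both real potentials and
    the maps [tau] into [Z]. *)
Lemma continuous_sum_lipschitz (T : pseudoMetricType R) (f : X * Z -> T) (K : R) :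
  (forall p q r, K * (mdist p.1 q.1 + mdist p.2 q.2) < r -> ball (f p) r (f q)) ->
  continuous f.
Proof.
move=> fK p; apply/cvg_ballP => e e0.
(* [K] may be negative or zero, hence the denominator [|K| + 1]. *)
pose d := e / (2 * (`|K| + 1)).
have K1 : 0 < `|K| + 1 by rewrite ltr_wpDl.
have d0 : 0 < d by rewrite divr_gt0// mulr_gt0.
near=> q; apply: fK.
have pq1 : mdist p.1 q.1 < d.
  suff : ball p.1 d q.1 by rewrite ballEmdist.
  by near: q; apply: (cvg_fst (F := nbhs p.1) (G := nbhs p.2)); exact: nbhsx_ballx.
have pq2 : mdist p.2 q.2 < d.
  suff : ball p.2 d q.2 by rewrite ballEmdist.
  by near: q; apply: (cvg_snd (F := nbhs p.1) (G := nbhs p.2)); exact: nbhsx_ballx.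
apply: (@le_lt_trans _ _ (`|K| * (d + d))).
  apply: le_trans (ler_wpM2r _ (ler_norm K)) _; first by rewrite addr_ge0 ?mdist_ge0.
  by apply: ler_wpM2l => //; rewrite lerD// ltW.
rewrite (_ : e = (`|K| + 1) * (d + d)).
  by rewrite ltr_pM2r ?addr_gt0// ltrDl.
by rewrite /d; field; rewrite lt0r_neq0.
Unshelve. all: by end_near. Qed.

Lemma lipschitz_sum_continuous (b : X * Z -> R) : lipschitz_sum b -> continuous b.
Proof.
move=> [K bK]; apply: (@continuous_sum_lipschitz _ _ K) => -[x1 z1] [x2 z2] r /=.
exact/le_lt_trans/bK.
Qed.

Lemma contractive_continuous (tau : X -> Z -> Z) : uniformly_contractive tau ->
  continuous (fun p : X * Z => tau p.1 p.2).
Proof.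
move=> [K _ tauK]; apply: (@continuous_sum_lipschitz _ _ K) => p q r.
by rewrite ballEmdist; apply: le_lt_trans; exact: tauK.
Qed.

Lemma continuous_snd_fun (f : Z -> R) : continuous f ->
  continuous (fun p : X * Z => f p.2).
Proof.
by move=> cf p; apply: (continuous_comp (f := snd)); [exact: cvg_snd | exact: cf].
Qed.

Lemma continuous_section (f : X * Z -> R) z : continuous f ->
  continuous (fun x => f (x, z)).
Proof.
move=> cf x; apply: (continuous_comp (f := fun x => (x, z))); last exact: cf.
by apply: cvg_pair => //; exact: cvg_cst.
Qed.

End product_space.

(** Both values of the exponential lie above its tangent at the barycentre [m]; the weighted sum of
    the linear parts vanishes. *)
Lemma expR_le_convex {R : realType} (s t a b : R) : 0 <= s -> 0 <= t -> s + t = 1 ->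
  expR (s * a + t * b) <= s * expR a + t * expR b.
Proof.
move=> s0 t0 st1.
have tangent (m x : R) : expR m * (1 + (x - m)) <= expR x.
  by rewrite -[in leRHS](subrKC m x) expRD ler_pM2l ?expR_gt0// expR_ge1Dx.
set m := s * a + t * b.
have := lerD (ler_wpM2l s0 (tangent m a)) (ler_wpM2l t0 (tangent m b)).
apply: le_trans.
rewrite [leRHS](_ : _ = expR m * (s + t + (m - (s + t) * m))).
  by rewrite st1 mul1r subrr addr0 mulr1.
by rewrite /m; ring.
Qed.

(** * The transfer operator at the constant 1, and bounds on the entropy *)

Section transfer_operator.
Context {R : realType} {X Z : pmetricType R}.
Hypotheses (cX : compact [set: X]) (cZ : compact [set: Z]).
Variables (tau : X -> Z -> Z) (alpha : borel_probability X R).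
Implicit Types (b : X * Z -> R).

(** This is [L_b(1)]; the map [tau] drops out because the test function is constant. *)
Definition exp_mass b z := \int[alpha]_x expR (b (x, z)).

Definition subnormal : set (X * Z -> R) :=
  [set b | lipschitz_sum b /\ forall z, exp_mass b z <= 1].

Lemma transfer_cst1 b : transfer tau alpha b (cst 1) = exp_mass b.
Proof.
apply/funext => z; apply: eq_Rintegral => x _; exact: mulr1.
Qed.

Lemma expR_section_continuous b z : lipschitz_sum b ->
  continuous (fun x => expR (b (x, z))).
Proof.
move=> /lipschitz_sum_continuous cb x.
apply: (continuous_comp (f := fun x => b (x, z))); last exact: continuous_expR.
exact: (continuous_section cb).
Qed.

Lemma section_min b z : lipschitz_sum b ->
  exists x0, forall x, b (x0, z) <= b (x, z).
Proof.
move=> lb.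
have [|||x0 _ bx0] := @compact_EVT_min X R (fun x => b (x, z)) setT.
- by exists point.
- exact: cX.
- by apply: continuous_subspaceT; exact/continuous_section/lipschitz_sum_continuous.
by exists x0 => x; exact/bx0/mem_set.
Qed.

(** A mean against a probability is at least the minimum. Hence the mass is positive, and a mass at
    most 1 forces [b <= 0] at the minimum. *)
Lemma expR_le_exp_mass b z x0 : lipschitz_sum b ->
  (forall x, b (x0, z) <= b (x, z)) -> expR (b (x0, z)) <= exp_mass b z.
Proof.
move=> lb bx0; rewrite -[leLHS](probability_Rintegral_cst alpha).
apply: continuous_Rintegral_le => //.
- exact: continuous_cst_fun.
- exact: expR_section_continuous.
- by move=> x; rewrite ler_expR.
Qed.

Lemma exp_mass_gt0 b z : lipschitz_sum b -> 0 < exp_mass b z.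
Proof.
move=> lb; have [x0 bx0] := section_min z lb.
exact: lt_le_trans (expR_gt0 _) (expR_le_exp_mass lb bx0).
Qed.

(** Lipschitz continuity of [ln L_b(1)] in multiplicative form: the integrands are compared at the
    same [x], so only the distance in [Z] enters. *)
Lemma exp_mass_lipschitz b : lipschitz_sum b -> exists K, forall z1 z2,
  exp_mass b z1 <= expR (K * mdist z1 z2) * exp_mass b z2.
Proof.
move=> lb; have [K bK] := lb; exists K => z1 z2; rewrite -continuous_RintegralZ//.
  apply: continuous_Rintegral_le => // [||x].
  - exact: expR_section_continuous.
  - by apply: continuousZ_fun; exact: expR_section_continuous.
  rewrite -expRD ler_expR -lerBlDr; apply: le_trans (ler_norm _) _.
  by have := bK x x z1 z2; rewrite mdistxx add0r.
exact: expR_section_continuous.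
Qed.

Lemma subnormal_normalize b : subnormal b -> exists b',
  [/\ lipschitz_sum b', transfer tau alpha b' (cst 1) = cst 1 &
      forall p, b p <= b' p].
Proof.
move=> [lb b1]; have [K bK] := exp_mass_lipschitz lb.
have [K' bK'] := lb.
have I0 z := exp_mass_gt0 z lb.
(* The sign of a Lipschitz constant is not prescribed, hence the absolute values. *)
have lnI z1 z2 : ln (exp_mass b z1) - ln (exp_mass b z2) <= `|K| * mdist z1 z2.
  rewrite lerBlDr -[leRHS]expRK -ler_expR expRK lnK ?posrE// expRD lnK ?posrE//.
  apply: le_trans (bK z1 z2) _; rewrite ler_pM2r// ler_expR ler_wpM2r ?mdist_ge0//.
  exact: ler_norm.
exists (fun p => b p - ln (exp_mass b p.2)); split.
- exists (`|K'| + `|K|) => x1 x2 z1 z2 /=.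
  rewrite (_ : _ - _ = b (x1, z1) - b (x2, z2) -
    (ln (exp_mass b z1) - ln (exp_mass b z2))); last by lra.
  apply: le_trans (ler_normB _ _) _; rewrite mulrDl; apply: lerD.
    apply: le_trans (bK' x1 x2 z1 z2) _.
    by rewrite ler_wpM2r ?addr_ge0 ?mdist_ge0// ler_norm.
  apply: (@le_trans _ _ (`|K| * mdist z1 z2)).
    rewrite ler_norml lnI andbT lerNl opprB.
    by apply: le_trans (lnI z2 z1) _; rewrite metric_sym.
  by rewrite ler_wpM2l// lerDr mdist_ge0.
- rewrite transfer_cst1; apply/funext => z; rewrite /exp_mass/=.
  have expI x : expR (b (x, z) - ln (exp_mass b z)) =
      (exp_mass b z)^-1 * expR (b (x, z)).
    by rewrite expRB lnK ?posrE// mulrC.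
  under eq_Rintegral do rewrite expI.
  rewrite continuous_RintegralZ//; last exact: expR_section_continuous.
  by rewrite mulVf// lt0r_neq0.
- by move=> p; rewrite lerDl oppr_ge0 -ln1 ler_ln ?posrE.
Qed.

Lemma normal_subnormal b : lipschitz_sum b ->
  transfer tau alpha b (cst 1) = cst 1 -> subnormal b.
Proof. by move=> lb; rewrite transfer_cst1 => b1; split=> // z; rewrite b1. Qed.

Lemma subnormal0 : subnormal (cst 0).
Proof.
split=> [|z]; first by exists 0 => x1 x2 z1 z2; rewrite subrr normr0 mul0r.
rewrite /exp_mass (_ : (fun x => _) = cst 1) ?probability_Rintegral_cst//.
by apply/funext => x; rewrite expR0.
Qed.

Lemma subnormal_convex b1 b2 (s t : R) : subnormal b1 -> subnormal b2 ->
  0 <= s -> 0 <= t -> s + t = 1 -> subnormal (fun p => s * b1 p + t * b2 p).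
Proof.
move=> [lb1 b11] [lb2 b21] s0 t0 st1; split=> [|z].
  have [K1 bK1] := lb1; have [K2 bK2] := lb2.
  exists (s * K1 + t * K2) => x1 x2 z1 z2.
  rewrite (_ : _ - _ = s * (b1 (x1, z1) - b1 (x2, z2)) +
     t * (b2 (x1, z1) - b2 (x2, z2))); last by lra.
  apply: le_trans (ler_normD _ _) _; rewrite !normrM (ger0_norm s0) (ger0_norm t0).
  rewrite mulrDl -!mulrA.
  by apply: lerD; exact: ler_wpM2l.
have ce1 := expR_section_continuous (z := z) lb1.
have ce2 := expR_section_continuous (z := z) lb2.
apply: (@le_trans _ _ (s * exp_mass b1 z + t * exp_mass b2 z)).
  rewrite -!continuous_RintegralZ// -continuous_RintegralD//;
    try exact: continuousZ_fun.
  apply: continuous_Rintegral_le => // [||x].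
  - move=> x; apply: (continuous_comp (f := fun x => s * b1 (x, z) + t * b2 (x, z))).
      by apply: continuousD_fun; apply: continuousZ_fun;
        exact/continuous_section/lipschitz_sum_continuous.
    exact: continuous_expR.
  - by apply: continuousD_fun; exact: continuousZ_fun.
  - exact: expR_le_convex.
by rewrite -st1 lerD// ler_piMr.
Qed.

Let cXZ : compact [set: X * Z].
Proof. by rewrite -setXTT; exact: compact_setX. Qed.

(** Normalizing [b] only increases its integral, so subnormal potentials also bound the entropy from
    above. *)
Lemma entropy_le (pi : borel_probability (X * Z)%type R) b : subnormal b ->
  (entropy tau alpha pi <= (- \int[pi]_p b p)%:E)%E.
Proof.
move=> nb; have [b' [lb' b'1 bb']] := subnormal_normalize nb.
rewrite /entropy EFinN leeN2; apply: le_ereal_sup_tmp.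
have cb' := lipschitz_sum_continuous lb'.
exists (\int[pi]_p (b' p)%:E)%E; first by exists b'.
rewrite continuous_integralE// lee_fin; apply: continuous_Rintegral_le => //.
by case: nb => lb _; exact: lipschitz_sum_continuous.
Qed.

Lemma entropy_ge (pi : borel_probability (X * Z)%type R) (M : R) :
  (forall b, subnormal b -> \int[pi]_p b p <= M) ->
  ((- M)%:E <= entropy tau alpha pi)%E.
Proof.
move=> bM; rewrite /entropy EFinN leeN2; apply: ge_ereal_sup => _ [b [lb b1] <-].
rewrite continuous_integralE; [|exact: cXZ|exact: lipschitz_sum_continuous].
by rewrite lee_fin; apply: bM; exact: normal_subnormal.
Qed.

(** Take [z] maximizing [g], so that the coboundary is nonpositive, then [x] minimizing [b] over the
    fibre of [z], where [b <= 0]. *)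
Lemma subnormal_coboundary b (g : Z -> R) : subnormal b -> continuous g ->
  exists x z, 0 <= - b (x, z) - (g (tau x z) - g z).
Proof.
move=> [lb b1] cg.
have [|||z _ gz] := @compact_EVT_max Z R g setT.
- by exists point.
- exact: cZ.
- exact: continuous_subspaceT.
have [x bx] := section_min z lb; exists x, z.
have : g (tau x z) <= g z by exact/gz/mem_set.
have : b (x, z) <= 0.
  by rewrite -ler_expR expR0; apply: le_trans (b1 z); exact: expR_le_exp_mass.
lra.
Qed.

End transfer_operator.

(** * Duality *)

Lemma continuous_distribution_Rintegral {R : realType} {S T : pseudoPMetricType R}
    (cS : compact [set: S]) (cT : compact [set: T]) (P : borel_probability S R)
    (phi : {mfun borel S >-> borel T}) (f : T -> R) :
  continuous (phi : S -> T) -> continuous f ->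
  \int[distribution P phi]_t f t = \int[P]_s f (phi s).
Proof.
move=> cphi cf; rewrite /Rintegral; congr fine; apply: integral_distribution.
  by apply/measurable_EFinP; exact: continuous_measurable.
apply: (continuous_integrable cS P (f := f \o phi)) => s.
by apply: continuous_comp; [exact: cphi | exact: cf].
Qed.

Section duality.
Context {R : realType} {X Y Z W : pmetricType R}.
Hypotheses (cX : compact [set: X]) (cY : compact [set: Y]).
Hypotheses (cZ : compact [set: Z]) (cW : compact [set: W]).
Variables (tauX : X -> Z -> Z) (tauY : Y -> W -> W).
Hypothesis htauX : uniformly_contractive tauX.
Hypothesis htauY : uniformly_contractive tauY.
Variables (alpha : borel_probability X R) (beta : borel_probability Y R).

Local Notation S := (X * Y * Z * W)%type.
Local Notation plan := (borel_probability (X * Y * Z * W)%type R).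
Implicit Types (k : S -> R) (pi : plan).

Let cS : compact [set: S].
Proof. by rewrite -!setXTT; do 3 apply: compact_setX => //. Qed.

Let cXZ : compact [set: X * Z].
Proof. by rewrite -setXTT; exact: compact_setX. Qed.

Let cYW : compact [set: Y * W].
Proof. by rewrite -setXTT; exact: compact_setX. Qed.

(** * Continuity of the projections of [X * Y * Z * W] *)

Lemma proj_X_continuous : continuous (proj_X : S -> X).
Proof.
move=> p; apply: (continuous_comp (f := fun p : S => p.1.1) (g := fst)).
  apply: (continuous_comp (f := fun p : S => p.1) (g := fst)); exact: cvg_fst.
exact: cvg_fst.
Qed.

Lemma proj_Y_continuous : continuous (proj_Y : S -> Y).
Proof.
move=> p; apply: (continuous_comp (f := fun p : S => p.1.1) (g := snd)).
  apply: (continuous_comp (f := fun p : S => p.1) (g := fst)); exact: cvg_fst.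
exact: cvg_snd.
Qed.

Lemma proj_XZ_continuous : continuous (proj_XZ : S -> X * Z).
Proof.
move=> p; apply: cvg_pair; first exact: proj_X_continuous.
apply: (continuous_comp (f := fun p : S => p.1) (g := snd)).
  exact: cvg_fst.
exact: cvg_snd.
Qed.

Lemma proj_YW_continuous : continuous (proj_YW : S -> Y * W).
Proof.
by move=> p; apply: cvg_pair; [exact: proj_Y_continuous | exact: cvg_snd].
Qed.

Lemma continuous_proj_X (f : X -> R) : continuous f ->
  continuous (fun s : S => f (proj_X s)).
Proof.
by move=> cf s; apply: continuous_comp; [exact: proj_X_continuous | exact: cf].
Qed.

Lemma continuous_proj_Y (f : Y -> R) : continuous f ->
  continuous (fun s : S => f (proj_Y s)).
Proof.
by move=> cf s; apply: continuous_comp; [exact: proj_Y_continuous | exact: cf].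
Qed.

Lemma continuous_proj_XZ (f : X * Z -> R) : continuous f ->
  continuous (fun s : S => f (proj_XZ s)).
Proof.
by move=> cf s; apply: continuous_comp; [exact: proj_XZ_continuous | exact: cf].
Qed.

Lemma continuous_proj_YW (f : Y * W -> R) : continuous f ->
  continuous (fun s : S => f (proj_YW s)).
Proof.
by move=> cf s; apply: continuous_comp; [exact: proj_YW_continuous | exact: cf].
Qed.

Lemma subnormal_proj_XZ b : subnormal alpha b ->
  continuous (fun s : S => b (proj_XZ s)).
Proof. by move=> [lb _]; exact/continuous_proj_XZ/lipschitz_sum_continuous. Qed.

Lemma subnormal_proj_YW b : subnormal beta b ->
  continuous (fun s : S => b (proj_YW s)).
Proof. by move=> [lb _]; exact/continuous_proj_YW/lipschitz_sum_continuous. Qed.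

(** Only the integrals against [pi] are compared, so this covers subtracting constants as well as
    [phi] and [psi]. The entropies may be infinite. *)
Lemma entropic_value_shift k k' (r : R) pi : continuous k -> continuous k' ->
  \int[pi]_s k' s = \int[pi]_s k s + r ->
  (entropic_value tauX tauY alpha beta k' pi =
   entropic_value tauX tauY alpha beta k pi + r%:E)%E.
Proof.
move=> ck ck' kr; rewrite /entropic_value !continuous_integralE// kr EFinD.
by rewrite -!addeA; congr (_ + _)%E; rewrite addeC addeA.
Qed.

Lemma entropic_value_le k pi b1 b2 : continuous k ->
  subnormal alpha b1 -> subnormal beta b2 ->
  (entropic_value tauX tauY alpha beta k pi <=
   (\int[pi]_s k s - \int[pi]_s b1 (proj_XZ s) - \int[pi]_s b2 (proj_YW s))%:E)%E.
Proof.
move=> ck nb1 nb2; rewrite /entropic_value continuous_integralE// !EFinB.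
have := entropy_le cX cZ tauX (distribution pi proj_XZ) nb1.
have := entropy_le cY cW tauY (distribution pi proj_YW) nb2.
rewrite !continuous_distribution_Rintegral//.
- by move=> H2 H1; apply: leeD => //; exact: leeD.
- exact: proj_XZ_continuous.
- by case: nb1 => lb _; exact: lipschitz_sum_continuous.
- exact: proj_YW_continuous.
- by case: nb2 => lb _; exact: lipschitz_sum_continuous.
Qed.

Definition coboundary (g1 : Z -> R) (g2 : W -> R) (s : S) : R :=
  (g1 (tauX s.1.1.1 s.1.2) - g1 s.1.2) + (g2 (tauY s.1.1.2 s.2) - g2 s.2).

Let continuous_cobX (g : Z -> R) : continuous g ->
  continuous (fun p : X * Z => g (tauX p.1 p.2)).
Proof.
move=> cg p; apply: (continuous_comp (f := fun p : X * Z => tauX p.1 p.2)).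
  exact: contractive_continuous.
exact: cg.
Qed.

Let continuous_cobY (g : W -> R) : continuous g ->
  continuous (fun p : Y * W => g (tauY p.1 p.2)).
Proof.
move=> cg p; apply: (continuous_comp (f := fun p : Y * W => tauY p.1 p.2)).
  exact: contractive_continuous.
exact: cg.
Qed.

Let continuous_cobXS (g : Z -> R) : continuous g ->
  continuous (fun s : S => g (tauX s.1.1.1 s.1.2) - g s.1.2).
Proof.
move=> cg; apply: (continuous_proj_XZ (f := fun p => g (tauX p.1 p.2) - g p.2)).
by apply: continuousB_fun; [exact: continuous_cobX | exact: continuous_snd_fun].
Qed.

Let continuous_cobYS (g : W -> R) : continuous g ->
  continuous (fun s : S => g (tauY s.1.1.2 s.2) - g s.2).
Proof.
move=> cg; apply: (continuous_proj_YW (f := fun p => g (tauY p.1 p.2) - g p.2)).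
by apply: continuousB_fun; [exact: continuous_cobY | exact: continuous_snd_fun].
Qed.

Lemma coboundary_continuous g1 g2 : continuous g1 -> continuous g2 ->
  continuous (coboundary g1 g2).
Proof.
move=> cg1 cg2.
exact: (continuousD_fun (continuous_cobXS cg1) (continuous_cobYS cg2)).
Qed.

(** Holonomy becomes the vanishing of [pi] on a linear space of continuous functions; taking
    [g1 = 0] or [g2 = 0] separates the two systems. *)
Lemma holonomic_plansP pi : holonomic_plans tauX tauY pi <->
  forall g1 g2, continuous g1 -> continuous g2 ->
    \int[pi]_s coboundary g1 g2 s = 0.
Proof.
have holX (g : Z -> R) : continuous g ->
    (\int[distribution pi proj_XZ]_p (g (tauX p.1 p.2))%:E =
     \int[distribution pi proj_XZ]_p (g p.2)%:E)%E <->
    \int[pi]_s (g (tauX s.1.1.1 s.1.2) - g s.1.2) = 0.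
  move=> cg; have c1 := continuous_cobX cg; have c2 := continuous_snd_fun (X := X) cg.
  rewrite !continuous_integralE//.
  rewrite !continuous_distribution_Rintegral//; try exact: proj_XZ_continuous.
  rewrite continuous_RintegralB//.
  + by split=> [[->]|/eqP]; [rewrite subrr | rewrite subr_eq0 => /eqP ->].
  + exact: (continuous_proj_XZ c1).
  + exact: (continuous_proj_XZ c2).
have holY (g : W -> R) : continuous g ->
    (\int[distribution pi proj_YW]_p (g (tauY p.1 p.2))%:E =
     \int[distribution pi proj_YW]_p (g p.2)%:E)%E <->
    \int[pi]_s (g (tauY s.1.1.2 s.2) - g s.2) = 0.
  move=> cg; have c1 := continuous_cobY cg; have c2 := continuous_snd_fun (X := Y) cg.
  rewrite !continuous_integralE//.
  rewrite !continuous_distribution_Rintegral//; try exact: proj_YW_continuous.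
  rewrite continuous_RintegralB//.
  + by split=> [[->]|/eqP]; [rewrite subrr | rewrite subr_eq0 => /eqP ->].
  + exact: (continuous_proj_YW c1).
  + exact: (continuous_proj_YW c2).
split=> [[hX hY] g1 g2 cg1 cg2|h0].
  rewrite continuous_RintegralD//; [|exact: continuous_cobXS|exact: continuous_cobYS].
  by rewrite ((holX _ cg1).1 (hX _ cg1)) ((holY _ cg2).1 (hY _ cg2)) addr0.
have c0 (T : topologicalType) : continuous (fun _ : T => 0 : R).
  exact: continuous_cst_fun.
split=> g cg.
  apply/(holX _ cg); rewrite -[RHS](h0 g (cst 0) cg (c0 _)).
  by apply: eq_Rintegral => s _; rewrite /coboundary subrr addr0.
apply/(holY _ cg); rewrite -[RHS](h0 (cst 0) g (c0 _) cg).
by apply: eq_Rintegral => s _; rewrite /coboundary subrr add0r.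
Qed.

(** The two suprema are taken in turn: over [b1] for fixed [b2], which bounds the first entropy
    below, then over [b2]. *)
Lemma entropic_value_ge0 k pi : continuous k ->
  (forall b1 b2, subnormal alpha b1 -> subnormal beta b2 ->
    \int[pi]_s b1 (proj_XZ s) + \int[pi]_s b2 (proj_YW s) <= \int[pi]_s k s) ->
  (0 <= entropic_value tauX tauY alpha beta k pi)%E.
Proof.
move=> ck kb; rewrite /entropic_value continuous_integralE//.
have intX b : subnormal alpha b ->
    \int[distribution pi proj_XZ]_p b p = \int[pi]_s b (proj_XZ s).
  move=> [lb _]; apply: continuous_distribution_Rintegral => //.
    exact: proj_XZ_continuous.
  exact: lipschitz_sum_continuous.
have intY b : subnormal beta b ->
    \int[distribution pi proj_YW]_p b p = \int[pi]_s b (proj_YW s).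
  move=> [lb _]; apply: continuous_distribution_Rintegral => //.
    exact: proj_YW_continuous.
  exact: lipschitz_sum_continuous.
set HX := entropy _ _ _; set HY := entropy _ _ _.
have HX_ge b2 : subnormal beta b2 ->
    ((- (\int[pi]_s k s - \int[pi]_s b2 (proj_YW s)))%:E <= HX)%E.
  move=> nb2; apply: entropy_ge => // b1 nb1.
  by rewrite intX// lerBrDr; exact: kb.
have HX_le0 : (HX <= 0)%E.
  have := entropy_le cX cZ tauX (distribution pi proj_XZ) (subnormal0 alpha).
  by rewrite probability_Rintegral_cst oppr0.
(* Finiteness, from [b2 = 0] below and [b1 = 0] above, allows this entropy to be moved across the
   next inequality. *)
have HX_fin : HX \is a fin_num.
  rewrite fin_real// (lt_le_trans _ (HX_ge _ (subnormal0 beta))) ?ltNyr//=.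
  exact: le_lt_trans HX_le0 (ltry 0).
have HY_ge : ((- (\int[pi]_s k s + fine HX))%:E <= HY)%E.
  apply: entropy_ge => // b2 nb2; rewrite intY//.
  by have := HX_ge _ nb2; rewrite -(fineK HX_fin) lee_fin/=; lra.
apply: le_trans (leeD (lexx _) HY_ge).
by rewrite -(fineK HX_fin) -!EFinD lee_fin/= subrr.
Qed.

(** The common form of both minimax arguments: [N] is the linear space of constraints. Nonnegativity
    of the integrals forces [pi] to vanish on [N], and [n = 0] leaves the inequality required by
    [entropic_value_ge0]. *)
Lemma plan_exists (N : set (S -> R)) k : continuous k ->
  N (cst 0) -> (forall n, N n -> continuous n) ->
  (forall n m (a b : R), N n -> N m -> N (fun s => a * n s + b * m s)) ->
  (forall n b1 b2, N n -> subnormal alpha b1 -> subnormal beta b2 ->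
    exists s, 0 <= k s - b1 (proj_XZ s) - b2 (proj_YW s) - n s) ->
  exists pi : plan, (forall n, N n -> \int[pi]_s n s = 0) /\
    (0 <= entropic_value tauX tauY alpha beta k pi)%E.
Proof.
move=> ck N0 Nc Nlin Nge.
pose f n b1 b2 (s : S) : R := k s - b1 (proj_XZ s) - b2 (proj_YW s) - n s.
pose G : set (S -> R) := [set h | exists n b1 b2,
  [/\ N n, subnormal alpha b1, subnormal beta b2 & h = f n b1 b2]].
have nX0 := subnormal0 (Z := Z) alpha; have nY0 := subnormal0 (Z := W) beta.
have [||||pi piG] := @minimax_probability R _ cS G.
- by exists (f (cst 0) (cst 0) (cst 0)), (cst 0), (cst 0), (cst 0).
- move=> _ [n [b1 [b2 [Nn nb1 nb2 ->]]]]; have cn := Nc _ Nn.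
  have cb1 := subnormal_proj_XZ nb1; have cb2 := subnormal_proj_YW nb2.
  by apply: continuousB_fun => //; apply: continuousB_fun => //; exact: continuousB_fun.
- move=> _ _ a b [n [b1 [b2 [Nn nb1 nb2 ->]]]] [m [b3 [b4 [Nm nb3 nb4 ->]]]] a0 b0 ab.
  exists (fun s => a * n s + b * m s), (fun p => a * b1 p + b * b3 p),
    (fun p => a * b2 p + b * b4 p).
  split; [exact: Nlin|exact: subnormal_convex|exact: subnormal_convex|].
  apply/funext => s; rewrite /f -[k s in RHS]mul1r -ab; ring.
- move=> _ [n [b1 [b2 [Nn nb1 nb2 ->]]]]; exact: Nge.
have intG n b1 b2 : N n -> subnormal alpha b1 -> subnormal beta b2 ->
    0 <= \int[pi]_s k s - \int[pi]_s b1 (proj_XZ s) - \int[pi]_s b2 (proj_YW s) -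
         \int[pi]_s n s.
  move=> Nn nb1 nb2; have cn := Nc _ Nn.
  have cb1 := subnormal_proj_XZ nb1; have cb2 := subnormal_proj_YW nb2.
  have c1 := continuousB_fun ck cb1; have c2 := continuousB_fun c1 cb2.
  have : 0 <= \int[pi]_s f n b1 b2 s by apply: piG; exists n, b1, b2.
  by rewrite /f !continuous_RintegralB.
have int0 n : N n -> \int[pi]_s n s = 0.
  move=> Nn; apply/eqP; apply/negPn/negP => n0.
  (* This multiple of [n] has integral [\int k + 1], which would give [0 <= -1]. *)
  have := intG (fun s => (\int[pi]_s k s + 1) / (\int[pi]_s n s) * n s + 0 * n s)
    _ _ (Nlin _ _ _ _ Nn Nn) nX0 nY0.
  have cn := Nc _ Nn.
  rewrite continuous_RintegralD//; [|exact: continuousZ_fun..].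
  rewrite !continuous_RintegralZ// !probability_Rintegral_cst divfK//; lra.
exists pi; split=> //; apply: entropic_value_ge0 => // b1 b2 nb1 nb2.
by have := intG _ _ _ N0 nb1 nb2; rewrite probability_Rintegral_cst; lra.
Qed.

(** * Finiteness of the pressure, and the two inequalities of the duality *)

Local Notation pressure := (marginal_pressure tauX tauY alpha beta).
Local Notation value := (entropic_value tauX tauY alpha beta).
Implicit Types (mu : borel_probability X R) (nu : borel_probability Y R).

Lemma coboundary_point b1 b2 g1 g2 : subnormal alpha b1 -> subnormal beta b2 ->
  continuous g1 -> continuous g2 ->
  exists s, 0 <= - b1 (proj_XZ s) - b2 (proj_YW s) - coboundary g1 g2 s.
Proof.
move=> nb1 nb2 cg1 cg2.
have [x [z xz]] := subnormal_coboundary cX cZ tauX nb1 cg1.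
have [y [w yw]] := subnormal_coboundary cY cW tauY nb2 cg2.
by exists (x, y, z, w); rewrite /coboundary /proj_XZ /proj_YW/=; lra.
Qed.

Lemma coboundary_lin g1 g2 h1 h2 (a b : R) :
  (fun s => a * coboundary g1 g2 s + b * coboundary h1 h2 s) =
  coboundary (fun z => a * g1 z + b * h1 z) (fun w => a * g2 w + b * h2 w).
Proof. by apply/funext => s; rewrite /coboundary; ring. Qed.

Lemma coboundary0 : coboundary (cst 0) (cst 0) = cst 0.
Proof. by apply/funext => s; rewrite /coboundary !subrr addr0. Qed.

Lemma continuous_lin (T : topologicalType) (f g : T -> R) (a b : R) :
  continuous f -> continuous g -> continuous (fun x => a * f x + b * g x).
Proof. by move=> cf cg; apply: continuousD_fun; exact: continuousZ_fun. Qed.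

(** Minimax with cost 0 and only the coboundaries as constraints; it keeps the pressure of every
    continuous function above [-oo]. *)
Lemma zero_value_plan : exists2 pi,
  holonomic_plans tauX tauY pi & (0 <= value (cst 0%R) pi)%E.
Proof.
pose N : set (S -> R) := [set n | exists g1 g2,
  [/\ continuous g1, continuous g2 & n = coboundary g1 g2]].
have [||||pi [piN pi0]] := @plan_exists N (cst 0) (@continuous_cst_fun _ _ 0).
- exists (cst 0), (cst 0); rewrite coboundary0.
  by split=> //; exact: continuous_cst_fun.
- by move=> _ [g1 [g2 [cg1 cg2 ->]]]; exact: coboundary_continuous.
- move=> _ _ a b [g1 [g2 [cg1 cg2 ->]]] [h1 [h2 [ch1 ch2 ->]]].
  rewrite coboundary_lin; eexists; eexists; split; last by [].
    exact: continuous_lin.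
  exact: continuous_lin.
- move=> _ b1 b2 [g1 [g2 [cg1 cg2 ->]]] nb1 nb2.
  have [s hs] := coboundary_point nb1 nb2 cg1 cg2.
  by exists s; rewrite sub0r.
exists pi => //; apply/holonomic_plansP => g1 g2 cg1 cg2.
by apply: piN; exists g1, g2.
Qed.

Lemma pressure_fin_num k : continuous k -> pressure k \is a fin_num.
Proof.
move=> ck; have [M kM] := continuous_compact_bound cS ck.
rewrite fin_real//; apply/andP; split; last first.
  apply: (@le_lt_trans _ _ M%:E); last exact: ltry.
  apply: ge_ereal_sup => _ [pi _ <-].
  apply: le_trans (entropic_value_le pi ck (subnormal0 alpha) (subnormal0 beta)) _.
  rewrite lee_fin !probability_Rintegral_cst !subr0.
  rewrite -[leRHS](probability_Rintegral_cst pi M).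
  apply: continuous_Rintegral_le => //; first exact: continuous_cst_fun.
  by move=> s; exact: le_trans (ler_norm _) (kM s).
have [pi hpi pi0] := zero_value_plan.
apply: lt_le_trans (ereal_sup_ubound (imageP (value k) hpi)).
rewrite (@entropic_value_shift (cst 0) k (\int[pi]_s k s))//; first last.
- by rewrite probability_Rintegral_cst add0r.
- exact: continuous_cst_fun.
by apply: lt_le_trans (leeD pi0 (lexx _)); rewrite add0e ltNyr.
Qed.

Lemma pressure_sub_cst k (a : R) : continuous k ->
  (pressure (fun s => k s - a)%R = pressure k - a%:E)%E.
Proof.
move=> ck; have ca : continuous (fun _ : S => a) by exact: continuous_cst_fun.
have cka : continuous (fun s => k s - a) by exact: continuousB_fun.
have shift pi : (value (fun s => k s - a)%R pi = value k pi - a%:E)%E.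
  rewrite -EFinN; apply: entropic_value_shift => //.
  by rewrite continuous_RintegralB// probability_Rintegral_cst.
apply/eqP; rewrite eq_le; apply/andP; split.
  apply: ge_ereal_sup => _ [pi hpi <-]; rewrite shift.
  by apply: leeD => //; exact: ereal_sup_ubound (imageP _ hpi).
rewrite leeBlDr//; apply: ge_ereal_sup => _ [pi hpi <-].
rewrite -leeBlDr// -shift; exact: ereal_sup_ubound (imageP _ hpi).
Qed.

Lemma coupling_marginalX mu nu pi (f : X -> R) :
  holonomic_couplings tauX tauY mu nu pi -> continuous f ->
  \int[pi]_s f (proj_X s) = \int[mu]_x f x.
Proof.
move=> [_ piX _] cf.
rewrite -(continuous_distribution_Rintegral cS cX)//; last exact: proj_X_continuous.
by rewrite /Rintegral; congr fine; apply: eq_measure_integral => A mA _; exact: piX.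
Qed.

Lemma coupling_marginalY mu nu pi (f : Y -> R) :
  holonomic_couplings tauX tauY mu nu pi -> continuous f ->
  \int[pi]_s f (proj_Y s) = \int[nu]_y f y.
Proof.
move=> [_ _ piY] cf.
rewrite -(continuous_distribution_Rintegral cS cY)//; last exact: proj_Y_continuous.
by rewrite /Rintegral; congr fine; apply: eq_measure_integral => A mA _; exact: piY.
Qed.

Lemma continuous_reduced_cost (c : S -> R) (phi : X -> R) (psi : Y -> R) :
  continuous c -> continuous phi -> continuous psi ->
  continuous (fun s : S => c s - phi s.1.1.1 - psi s.1.1.2).
Proof.
move=> cc cphi cpsi; apply: continuousB_fun; last exact: (continuous_proj_Y cpsi).
by apply: continuousB_fun => //; exact: (continuous_proj_X cphi).
Qed.

(** On a coupling, the value of the reduced cost is that of [c] minus the two integrals, and it is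
    at most the pressure, which is 0. *)
Lemma weak_duality (c : S -> R) mu nu (phi : X -> R) (psi : Y -> R) pi :
  continuous c -> continuous phi -> continuous psi ->
  pressure (fun s => c s - phi s.1.1.1 - psi s.1.1.2) = 0%E ->
  holonomic_couplings tauX tauY mu nu pi ->
  (value c pi <= (\int[mu]_x phi x + \int[nu]_y psi y)%:E)%E.
Proof.
move=> cc cphi cpsi P0 hpi; have ck := continuous_reduced_cost cc cphi cpsi.
rewrite (@entropic_value_shift _ c (\int[mu]_x phi x + \int[nu]_y psi y) pi ck)//.
  rewrite -[leRHS]add0e leeD// -P0; apply: ereal_sup_ubound; exists pi => //.
  by case: hpi.
rewrite -(coupling_marginalX hpi cphi) -(coupling_marginalY hpi cpsi).
have c1 := continuous_proj_X cphi; have c2 := continuous_proj_Y cpsi.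
rewrite continuous_RintegralB//; last exact: (continuousB_fun cc c1).
by rewrite continuous_RintegralB//; lra.
Qed.

(** Coboundaries integrate to 0 against a holonomic plan, so they may be subtracted before the
    pointwise bound is applied. *)
Lemma pressure_le (k : S -> R) b1 b2 g1 g2 (M : R) : continuous k ->
  subnormal alpha b1 -> subnormal beta b2 -> continuous g1 -> continuous g2 ->
  (forall s, k s - b1 (proj_XZ s) - b2 (proj_YW s) - coboundary g1 g2 s <= M) ->
  (pressure k <= M%:E)%E.
Proof.
move=> ck nb1 nb2 cg1 cg2 kM; apply: ge_ereal_sup => _ [pi hpi <-].
have cb1 := subnormal_proj_XZ nb1; have cb2 := subnormal_proj_YW nb2.
have cg := coboundary_continuous cg1 cg2.
have c1 := continuousB_fun ck cb1; have c2 := continuousB_fun c1 cb2.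
apply: le_trans (entropic_value_le pi ck nb1 nb2) _.
rewrite lee_fin -[leLHS]subr0 -((holonomic_plansP pi).1 hpi g1 g2 cg1 cg2).
rewrite -!continuous_RintegralB// -[leRHS](probability_Rintegral_cst pi M).
apply: continuous_Rintegral_le => //; first exact: continuousB_fun.
exact: continuous_cst_fun.
Qed.

Lemma strong_duality (c : S -> R) mu nu (d : R) : continuous c ->
  (forall (phi : X -> R) (psi : Y -> R), continuous phi -> continuous psi ->
    pressure (fun s => c s - phi s.1.1.1 - psi s.1.1.2) = 0%E ->
    d < \int[mu]_x phi x + \int[nu]_y psi y) ->
  exists2 pi, holonomic_couplings tauX tauY mu nu pi & (d%:E <= value c pi)%E.
Proof.
move=> cc d_lt.
pose n phi psi g1 g2 (s : S) : R := (phi (proj_X s) - \int[mu]_x phi x) +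
  (psi (proj_Y s) - \int[nu]_y psi y) + coboundary g1 g2 s.
pose N : set (S -> R) := [set f | exists phi psi g1 g2,
  [/\ continuous phi, continuous psi, continuous g1, continuous g2 &
   f = n phi psi g1 g2]].
have c0 (T : topologicalType) : continuous (cst 0 : T -> R).
  exact: continuous_cst_fun.
(* Shifting the cost by [d] turns a nonnegative value into a value at least [d] for [c]. *)
have cd : continuous (fun s => c s - d).
  by apply: continuousB_fun => //; exact: continuous_cst_fun.
have [||||pi [piN pi0]] := @plan_exists N _ cd.
- exists (cst 0), (cst 0), (cst 0), (cst 0); split; [exact: c0..|].
  apply/funext => s; rewrite /n !probability_Rintegral_cst coboundary0/=.
  by rewrite subrr !addr0.
- move=> _ [phi [psi [g1 [g2 [cphi cpsi cg1 cg2 ->]]]]].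
  have cX' : continuous (fun s : S => phi (proj_X s) - \int[mu]_x phi x).
    apply: continuousB_fun; first exact: continuous_proj_X.
    exact: continuous_cst_fun.
  have cY' : continuous (fun s : S => psi (proj_Y s) - \int[nu]_y psi y).
    apply: continuousB_fun; first exact: continuous_proj_Y.
    exact: continuous_cst_fun.
  exact: (continuousD_fun (continuousD_fun cX' cY') (coboundary_continuous cg1 cg2)).
- move=> _ _ a b [phi [psi [g1 [g2 [cphi cpsi cg1 cg2 ->]]]]]
    [phi' [psi' [h1 [h2 [cphi' cpsi' ch1 ch2 ->]]]]].
  exists (fun x => a * phi x + b * phi' x), (fun x => a * psi x + b * psi' x),
    (fun x => a * g1 x + b * h1 x), (fun x => a * g2 x + b * h2 x).
  split; [exact: continuous_lin..|].
  apply/funext => s; rewrite /n -coboundary_lin.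
  rewrite !continuous_RintegralD//; try exact: continuousZ_fun.
  by rewrite !continuous_RintegralZ//; ring.
- move=> _ b1 b2 [phi [psi [g1 [g2 [cphi cpsi cg1 cg2 ->]]]]] nb1 nb2.
  apply/not_existsP => hneg.
  pose k (s : S) := c s - phi s.1.1.1 - psi s.1.1.2.
  have ck : continuous k by exact: continuous_reduced_cost.
  pose Iphi := \int[mu]_x phi x; pose Ipsi := \int[nu]_y psi y.
  have : (pressure k <= (d - Iphi - Ipsi)%:E)%E.
    apply: (pressure_le ck nb1 nb2 cg1 cg2) => s.
    have /negP := hneg s; rewrite -ltNge /n /k /Iphi /Ipsi /proj_X /proj_Y/=; lra.
  have pfin := pressure_fin_num ck; rewrite -(fineK pfin) lee_fin => p_le.
  pose p := fine (pressure k).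
  have cphip : continuous (fun x => phi x + p).
    by apply: continuousD_fun => //; exact: continuous_cst_fun.
  (* Replacing [phi] by [phi + p] makes the pressure 0, so that [d < Iphi + p + Ipsi], against
     [p_le]. *)
  have := d_lt _ _ cphip cpsi; rewrite (_ : (fun s => _) = (fun s => k s - p)).
    rewrite pressure_sub_cst// /p fineK// subee// => /(_ erefl).
    rewrite continuous_RintegralD//; last exact: continuous_cst_fun.
    rewrite probability_Rintegral_cst; rewrite -/Iphi -/Ipsi -/p in p_le *; lra.
  by apply/funext => s; rewrite /k; lra.
(* Setting all functions to zero except [g1] and [g2], or [phi], or [psi], isolates holonomy and
   each marginal condition. *)
have int_n phi psi g1 g2 : continuous phi -> continuous psi -> continuous g1 ->
    continuous g2 -> \int[pi]_s n phi psi g1 g2 s = 0.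
  by move=> cphi cpsi cg1 cg2; apply: piN; exists phi, psi, g1, g2.
exists pi; last first.
  rewrite (@entropic_value_shift (fun s => c s - d) c d)//.
    by rewrite -[leLHS]add0e leeD.
  rewrite continuous_RintegralB//; last exact: continuous_cst_fun.
  by rewrite probability_Rintegral_cst subrK.
split.
- apply/holonomic_plansP => g1 g2 cg1 cg2.
  rewrite -[RHS](int_n (cst 0) (cst 0) g1 g2)//; [|exact: c0..].
  apply: eq_Rintegral => s _; rewrite /n !probability_Rintegral_cst/=.
  by rewrite subrr !add0r.
- apply: borel_probability_eq => // phi cphi.
  rewrite continuous_distribution_Rintegral//; last exact: proj_X_continuous.
  have cpX := continuous_proj_X cphi.
  apply/eqP; rewrite -subr_eq0; apply/eqP.
  rewrite -[RHS](int_n phi (cst 0) (cst 0) (cst 0))//; [|exact: c0..].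
  rewrite -[X in _ - X = _](probability_Rintegral_cst pi) -continuous_RintegralB//.
    apply: eq_Rintegral => s _; rewrite /n probability_Rintegral_cst coboundary0/=.
    by rewrite subrr !addr0.
  exact: continuous_cst_fun.
- apply: borel_probability_eq => // psi cpsi.
  rewrite continuous_distribution_Rintegral//; last exact: proj_Y_continuous.
  have cpY := continuous_proj_Y cpsi.
  apply/eqP; rewrite -subr_eq0; apply/eqP.
  rewrite -[RHS](int_n (cst 0) psi (cst 0) (cst 0))//; [|exact: c0..].
  rewrite -[X in _ - X = _](probability_Rintegral_cst pi) -continuous_RintegralB//.
    apply: eq_Rintegral => s _; rewrite /n probability_Rintegral_cst coboundary0/=.
    by rewrite subrr add0r addr0.
  exact: continuous_cst_fun.
Qed.

End duality.

(** Either side of the duality may be infinite, while [strong_duality] takes a real [d]. *)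
Lemma lte_dense {R : realType} (x y : \bar R) : (x < y)%E ->
  exists r : R, (x < r%:E < y)%E.
Proof.
case: x y => [x| |] [y| |]//; rewrite ?lte_fin.
- by move=> xy; exists ((x + y) / 2); rewrite !lte_fin; apply/andP; split; lra.
- by move=> _; exists (x + 1); rewrite lte_fin ltry ltrDl ltr01.
- by move=> _; exists (y - 1); rewrite lte_fin ltNyr gtrBl ltr01.
- by move=> _; exists 0; rewrite ltNyr ltry.
Qed.

Theorem theorem19 (R : realType) (X Y Z W : pmetricType R)
  (cX : compact [set: X]) (cY : compact [set: Y])
  (cZ : compact [set: Z]) (cW : compact [set: W])
  (tauX : X -> Z -> Z) (tauY : Y -> W -> W)
  (htauX : uniformly_contractive tauX) (htauY : uniformly_contractive tauY)
  (alpha : borel_probability X R) (beta : borel_probability Y R)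
  (halpha : full_support alpha) (hbeta : full_support beta)
  (mu : borel_probability X R) (nu : borel_probability Y R)
  (c : X * Y * Z * W -> R) (hc : continuous c) :
  ereal_inf [set (\int[mu]_x (fp.1 x)%:E + \int[nu]_y (fp.2 y)%:E)%E | fp in
    [set fp : (X -> R) * (Y -> R) |
      [/\ continuous fp.1, continuous fp.2 &
        marginal_pressure tauX tauY alpha beta
          (fun p => c p - fp.1 p.1.1.1 - fp.2 p.1.1.2) = 0%E]]]
  = ereal_sup [set entropic_value tauX tauY alpha beta c pi |
      pi in holonomic_couplings tauX tauY mu nu].
Proof.
apply/eqP; rewrite eq_le; apply/andP; split; last first.
  apply: ge_ereal_sup => _ [pi hpi <-].
  apply: le_ereal_inf_tmp => _ [[phi psi] /= [cphi cpsi P0] <-].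
  rewrite !continuous_integralE// -EFinD.
  exact: (weak_duality cX cY cZ cW hc cphi cpsi P0 hpi).
(* A gap between the supremum and the infimum contains a real [d]; [strong_duality] then produces a
   coupling of value at least [d], above the supremum. *)
rewrite leNgt; apply/negP => /lte_dense[d /andP[sup_d d_inf]].
have [phi psi cphi cpsi P0|pi hpi d_pi] :=
  @strong_duality _ _ _ _ _ cX cY cZ cW _ _ htauX htauY alpha beta c mu nu d hc.
  rewrite -lte_fin EFinD -!continuous_integralE//.
  by apply: lt_le_trans d_inf _; apply: ereal_inf_lbound; exists (phi, psi).
have := le_trans d_pi (ereal_sup_ubound (imageP _ hpi)).
by rewrite leNgt sup_d.
Qed.
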